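(* Let $d\ge 1$ and let $(\tau,B)$ be a random pair (the job law), where $\tau\ge 0$ and $B$ is a.s. a finite non-empty subset of $\mathbb{Z}^d$. Suppose there exists $\epsilon>0$ such that $$\mathbb{E}\,\tau^{d+1+\epsilon}+\mathbb{E}\,(\operatorname{diam}B)^{d+1+\epsilon}<\infty .$$ Then there exists $\lambda_0>0$ such that for every job arrival rate $\lambda<\lambda_0$ ($\lambda>0$) the Poisson hail system with arrival rate $\lambda$ and job law $(\tau,B)$ is stable.
   Context: Notation: $|x|_\infty=\max_{1\le i\le d}|x_i|$ and $\operatorname{diam}B=\max_{x,y\in B}|x-y|_\infty$. Poisson hail system. For each site $w\in\mathbb{Z}^d$, independently over $w$, jobs (hailstones) arrive at $w$ at the points of a Poisson process of rate $\lambda$ on the time axis; a job arriving at $w$ carries a mark $(\tau,B'+w)$, where the pairs $(\tau,B')$ are i.i.d. copies of the job law $(\tau,B)$, independent of the arrival times. A job with mark $(\tau,A)$ requires $\tau$ units of simultaneous service from all servers (sites) in $A$. Let $W(t,x)$ be the workload at site $x$ at time $t$. If a job with mark $(\tau,A)$ arrives at time $t$, then $W(t,x)=\max_{y\in A}W(t-,y)+\tau$ for $x\in A$ and $W(t,x)=W(t-,x)$ for $x\notin A$; between arrivals of jobs whose set contains $x$, $W(\cdot,x)$ decreases linearly at rate $1$ until it reaches $0$, where it stays. Since infinitely many jobs arrive in every time interval, the workload is given precisely by the path representation: starting from full vacancy at time $0$, $W(t,x)=\sup_\gamma V(\gamma)\in[0,\infty]$, the supremum being over all piecewise constant cadlag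 paths $\gamma:[u,t]\to\mathbb{Z}^d$, $0\le u\le t$, with $\gamma(t)=x$ and such that whenever $\gamma(s)\ne\gamma(s-)$ a job arrives at time $s$ whose set contains both $\gamma(s)$ and $\gamma(s-)$; the score is $V(\gamma)=\sum_i\tau_i-(t-u)$, the sum being over all jobs $(\tau_i,A_i)$ arriving at times $s_i\in(u,t]$ with $\gamma(s_i)\in A_i$. Stable: starting from full vacancy at time $0$ (zero workload at every site), for each fixed $x\in\mathbb{Z}^d$ the family of distributions of $W(t,x)$, $t\ge 0$, is tight (as distributions on $[0,\infty)$). *)

(* Defs.v *)
From HB Require Import structures.
From mathcomp Require Import all_boot all_order all_algebra finmap.
From mathcomp Require Import all_classical all_reals all_analysis.
From mathcomp Require Import measurable_realfun.

Set Implicit Arguments.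
Unset Strict Implicit.
Unset Printing Implicit Defensive.

Import Order.TTheory GRing.Theory Num.Theory.
Import numFieldNormedType.Exports.

Local Open Scope classical_set_scope.
Local Open Scope card_scope.
Local Open Scope ring_scope.

Notation site d := 'rV[int]_d.

(* {fset site d} is countable, so it carries the discrete sigma-algebra *)
Definition siteset (d : nat) := {fset site d}.

HB.instance Definition _ (d : nat) := Pointed.on (siteset d).
HB.instance Definition _ (d : nat) := @isMeasurable.Build default_measure_display
  (siteset d) (@discrete_measurable (siteset d))
  (@discrete_measurable0 (siteset d)) (@discrete_measurableC (siteset d))
  (@discrete_measurableU (siteset d)).

Definition supnorm (d : nat) (x : site d) : nat := (\max_(i < d) `|x ord0 i|)%N.

Definition diam (d : nat) (B : {fset site d}) : nat :=
  (\max_(x <- B) \max_(y <- B) supnorm (x - y))%N.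

Definition translate (d : nat) (B : {fset site d}) (w : site d) : {fset site d} :=
  [fset (y + w)%R | y in B]%fset.

Section configuration.
Context {R : realType} {d : nat}.

(* The job (w, n) is the n-th one arriving at the site w. *)
Notation job := (site d * nat)%type.

Record configuration := Configuration {
  time : job -> R;
  service : job -> R;
  servers : job -> {fset site d}
}.

Implicit Types (c : configuration) (g : R -> site d) (t u : R) (x : site d).

(* g is only relevant on [u, t]; n = 0 is the degenerate interval u = t *)
Definition piecewise_constant_cadlag u t g :=
  exists (n : nat) (s : nat -> R),
    [/\ s 0%N = u, s n = t,
        forall i, (i < n)%N -> s i < s i.+1 &
        forall i r, (i < n)%N -> s i <= r < s i.+1 -> g r = g (s i)].

(* y below is the left limit g(s-), in the discrete topology *)
Definition admissible_path c u t g :=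
  piecewise_constant_cadlag u t g /\
  forall s y, u < s <= t -> (\forall r \near s^'-, g r = y) -> g s <> y ->
    exists j : job, [/\ time c j = s, g s \in servers c j & y \in servers c j].

Definition score c u t g : \bar R :=
  (\esum_(j in [set j | (u < time c j <= t)%R /\ g (time c j) \in servers c j])
     (service c j)%:E - (t - u)%:E)%E.

Definition workload_of c t x : \bar R :=
  ereal_sup [set v | exists u g,
    [/\ (0 <= u <= t)%R, admissible_path c u t g, g t = x & v = score c u t g]].

End configuration.
Arguments configuration : clear implicits.

Section random.
Context {disp : measure_display} {Omega : measurableType disp} {R : realType}.
Variable P : probability Omega R.

Definition mutually_independent (I : choiceType) (S : I -> set (set Omega)) :=
  forall (F : {fset I}) (E : I -> set Omega),
    (forall i, i \in F -> S i (E i)) ->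
    P (\bigcap_(i in [set` F]) E i) = (\prod_(i <- F) P (E i))%E.

(* sigma-algebra generated by a random element / by a sequence of them *)
Definition sigma_of d' (T : measurableType d') (X : Omega -> T) :
    set (set Omega) :=
  preimage_set_system setT X measurable.

Definition sigma_of_seq d' (T : measurableType d') (X : nat -> Omega -> T) :
    set (set Omega) :=
  <<s \bigcup_n sigma_of (X n) >>.

(* The points in (0, +oo) of a Poisson process of rate lambda, enumerated in
   increasing order: the numbers of points in successive intervals
   (a i, a i.+1] are independent and Poisson. *)
Definition poisson_process (lambda : R) (T : nat -> Omega -> R) :=
  [/\ forall n, measurable_fun setT (T n),
      forall om, 0 < T 0%N om,
      forall n om, T n om < T n.+1 om &
      forall (m : nat) (a : nat -> R) (k : nat -> nat),
        0 <= a 0%N -> (forall i, (i < m)%N -> a i < a i.+1) ->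
        P (\bigcap_(i in `I_m)
             [set om | [set n | (a i < T n om <= a i.+1)%R] #= `I_(k i)]) =
        (\prod_(i < m)
           (poisson_pmf (lambda * (a i.+1 - a i)) (k i))%:E)%E].

(* mark w n = (tau, B'), the server set of the job being B' + w; law is the
   distribution of (tau, B). *)
Record poisson_hail (d : nat) (lambda : R)
    (law : set (R * siteset d) -> \bar R) := PoissonHail {
  arrival : site d -> nat -> Omega -> R;
  mark : site d -> nat -> Omega -> R * siteset d;
  arrivalP : forall w, poisson_process lambda (arrival w);
  measurable_mark : forall w n, measurable_fun setT (mark w n);
  mark_law : forall w n A, measurable A -> pushforward P (mark w n) A = law A;
  independence : mutually_independent
    (fun i : site d + site d * nat => match i with
       | inl w => sigma_of_seq (arrival w)
       | inr j => sigma_of (mark j.1 j.2)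
       end)
}.

Section workload.
Variables (d : nat) (lambda : R) (law : set (R * siteset d) -> \bar R).
Variable H : poisson_hail lambda law.

Definition hail_configuration (om : Omega) : configuration R d :=
  Configuration
    (fun j => arrival H j.1 j.2 om)
    (fun j => (mark H j.1 j.2 om).1)
    (fun j => translate (mark H j.1 j.2 om).2 j.1).

Definition workload (t : R) (x : site d) (om : Omega) : \bar R :=
  workload_of (hail_configuration om) t x.

(* Tightness is that of distributions on the finite half-line: the compact set
   K consists of real numbers, so it excludes the value +oo of the workload. *)
Definition stable :=
  forall x : site d,
    (forall t : R, 0 <= t -> measurable_fun setT (workload t x)) /\
    (forall e : R, 0 < e ->
       exists2 K : set R, compact K &
         forall t : R, 0 <= t ->
           (pushforward P (workload t x) (~` (EFin @` K)) <= e%:E)%E).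

End workload.
End random.

(* Main.v *)
(* A path of duration T whose jumps have total length D is viewed as a space-time
   path of length L = T + D. Jobs are sorted into classes: those of class k have
   service time and diameter at most 2^k, but not both at most 2^(k-1). A path
   that touches m jobs of class k yields a chain of m distinct jobs of class k of
   total space-time length about L. Arrivals being Poisson and marks independent,
   the expected number of such chains, weighted by exp (- length / l), is at most
   (C lambda P(class k) l^(d+1))^m. The moment of order d + 1 + eps allows one to
   take l = l_k larger than 2^k by a factor K a^k with a > 1 and still have the
   bracket at most exp(-2) a^(-k) for lambda small. Hence, outside an event whose
   probability is summable over k and over L = 2^n, every path of length at most L
   touches at most L / l_k jobs of class k, for every k, so that the sizes of the
   touched jobs sum to at most L (sum_k 2^k / l_k) <= L / (8 d). This sum controls
   both D and the total service, and a path with L > 2^n0 therefore has a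
   nonpositive score, whence W <= 2^n0. *)

Require Import Defs.
From HB Require Import structures.
From mathcomp Require Import all_boot all_order all_algebra finmap.
From mathcomp Require Import all_classical all_reals all_analysis.
From mathcomp Require Import measurable_realfun.
From mathcomp Require Import zify ring lra.

Set Implicit Arguments.
Unset Strict Implicit.
Unset Printing Implicit Defensive.

Import Order.TTheory GRing.Theory Num.Theory.
Import numFieldNormedType.Exports.

Local Open Scope classical_set_scope.
Local Open Scope ring_scope.

(** * Arrivals in unit time slots *)

(** Unit time slots make the possible chains countable, so that a union bound applies. Jobs are
    numbered by order of arrival at their site, hence which indices fall into a slot is random.
    Fixing the number of jobs in each relevant slot fixes these indices; since the jobs of a chain
    are distinct, the choices are counted by falling factorials, whose Poisson expectations are
    powers of [lambda].

    The exponent d + 1 is the dimension of space-time: weights with decay length l sum to order l in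
    each of the d space coordinates and in time. Sizes have only polynomial moments, so a single
    exponential estimate over jobs of all sizes is out of reach; within one class the sizes are
    bounded.

    D enters the length L, and the bound on D is in terms of L. This is not circular: L is fixed as
    a dyadic scale before the touched jobs are counted, and the factor 8 d leaves D at most L /
    8. *)

Lemma increasing_pos_mono (R : realType) (T : nat -> R) (T0 : 0 < T 0%N)
    (T_incr : forall n, T n < T n.+1) :
  (forall n, 0 < T n) /\ {homo T : m n / (m <= n)%N >-> m <= n}.
Proof.
have hom : {homo T : m n / (m <= n)%N >-> m <= n}.
  by apply/nondecreasing_seqP => n; exact/ltW.
by split=> // n; exact: lt_le_trans T0 (hom _ _ (leq0n n)).
Qed.

(** A downward closed set of naturals is either everything, which the finite count rules out, or
    some [I_M] with [M - K = c]. The subtraction is truncated, hence a separate case [M < K] at the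
    end. *)
Lemma card_initial_segment (P : set nat) (K c : nat) :
  (forall m n, (m <= n)%N -> P n -> P m) ->
  ([set n | (K <= n)%N /\ P n] #= `I_c)%card ->
  forall n, (K <= n)%N -> P n <-> (n < K + c)%N.
Proof.
move=> dP cardP.
have shift (A : set nat) : injective (addn K) ->
    [set n | (K <= n)%N /\ P n] = addn K @` A -> (A #= `I_c)%card.
  move=> inj E; rewrite E in cardP.
  apply: card_eq_trans cardP; rewrite card_eq_sym.
  by apply: inj_card_eq; exact: in2W.
have inj : injective (addn K) by exact: addnI.
have [[N nPN]|] := pselect (exists N, ~ P N); last first.
  move=> /forallNP allP; exfalso.
  have /shift : [set n | (K <= n)%N /\ P n] = addn K @` setT.
    apply/seteqP; split=> [n [Kn _]|_ [n _ <-]] /=.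
      by exists (n - K)%N => //; rewrite subnKC.
    by split; [rewrite leq_addr | exact: contrapT (allP _)].
  by move=> /(_ inj) cT; apply: infinite_nat; apply/finite_setP; exists c.
have ex : exists N, `[< ~ P N >] by exists N; apply/asboolP.
pose M := ex_minn ex.
have PM n : P n <-> (n < M)%N.
  rewrite /M; case: ex_minnP => m /asboolP nPm minm; split.
    by move=> Pn; rewrite ltnNge; apply/negP => /dP/(_ Pn).
  move=> nm; apply: contrapT => nPn; move: nm.
  by rewrite ltnNge minm//; exact/asboolP.
have /shift : [set n | (K <= n)%N /\ P n] = addn K @` `I_(M - K).
  apply/seteqP; split=> [n [Kn /PM nM]|_ [n /= nMK <-]] /=.
    by exists (n - K)%N; rewrite ?subnKC//= ltn_sub2r//; exact: leq_ltn_trans nM.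
  by split; [rewrite leq_addr | apply/PM; rewrite -ltn_subRL].
move=> /(_ inj); move=> /card_eq_II MK n Kn.
rewrite PM -MK; split=> nM; first by rewrite subnKC// ltnW// (leq_ltn_trans Kn).
by have [KM|MK'] := leqP K M; [rewrite subnKC in nM | lia].
Qed.

(** Increasing arrival times make successive slots occupy consecutive blocks of indices, so the
    counts of the first slots determine which indices each of them contains. *)
Lemma slot_indices (R : realType) (T : nat -> R) (q : nat) (k : nat -> nat) :
  0 < T 0%N -> (forall n, T n < T n.+1) ->
  (forall i, (i < q)%N -> ([set n | (i%:R < T n <= i.+1%:R)%R] #= `I_(k i))%card) ->
  forall i n, (i < q)%N -> i%:R < T n <= i.+1%:R ->
    n \in iota (\sum_(j < i) k j) (k i).
Proof.
move=> T0 T_incr cardT.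
have [Tpos Tmono] := increasing_pos_mono T0 T_incr.
have step i : (i < q)%N ->
    (forall n, T n <= i%:R <-> (n < \sum_(j < i) k j)%N) ->
    forall n, T n <= i.+1%:R <-> (n < \sum_(j < i) k j + k i)%N.
  move=> iq IH n.
  have E : [set n | (i%:R < T n <= i.+1%:R)%R] =
      [set n | (\sum_(j < i) k j <= n)%N /\ T n <= i.+1%:R].
    apply/seteqP; split=> m /=.
      by move=> /andP[im ->]; split=> //; rewrite leqNgt; apply/negP => /IH; rewrite leNgt im.
    by move=> [im ->]; rewrite andbT ltNge; apply/negP => /IH; rewrite ltnNge im.
  have [Kn|nK] := leqP (\sum_(j < i) k j)%N n.
    apply: (@card_initial_segment (fun n => T n <= i.+1%:R)) Kn; last by rewrite -E cardT.
    by move=> m m' mm' /(le_trans (Tmono _ _ mm')).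
  split=> _; first exact: ltn_addr.
  by move/IH : nK => /le_trans; apply; rewrite ler_nat.
have below i : (i <= q)%N -> forall n, T n <= i%:R <-> (n < \sum_(j < i) k j)%N.
  elim: i => [_ n|i IH iq n]; last by rewrite big_ord_recr/=; apply: step => //; exact/IH/ltnW.
  by rewrite big_ord0; split=> //; rewrite leNgt Tpos.
move=> i n iq /andP[Ti Ti1]; rewrite mem_iota; apply/andP; split.
  by rewrite leqNgt; apply/negP => /(below i (ltnW iq)); rewrite leNgt Ti.
by move/(below i.+1 iq) : Ti1; rewrite big_ord_recr.
Qed.

(** * Counting choices of pairwise distinct jobs *)

Section distinct_picks.
Context {T : eqType} (X : T -> seq nat).
Hypothesis X_uniq : forall s, uniq (X s).

Fixpoint picks (ss : seq T) : seq (seq nat) :=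
  if ss is s :: ss' then
    [seq n :: ns | ns <- picks ss', n <- [seq n <- X s | (s, n) \notin zip ss' ns]]
  else [:: [::]].

Lemma mem_picks ss ns : ns \in picks ss =
  [&& size ns == size ss, uniq (zip ss ns) &
      all (fun p => p.2 \in X p.1) (zip ss ns)].
Proof.
elim: ss ns => [|s ss IH] [|n ns] //=.
  by apply/allpairsPdep => -[x [y [_ _]]].
apply/allpairsPdep/idP => [[x [y [xss]]]|].
  rewrite mem_filter => /andP[nz yX] [-> ->].
  by move: xss; rewrite IH => /and3P[/eqP-> -> ->]; rewrite nz yX eqxx.
rewrite eqSS => /and3P[sz /andP[nz un] /andP[nX al]].
by exists ns, n; split=> //; [rewrite IH sz un al | rewrite mem_filter nz].
Qed.

(** Each further occurrence of a slot [s] must avoid the indices already used for [s], which is how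
    a falling factorial grows. A plain power would not match the factorial moments of the Poisson
    law. *)
Lemma size_picks ss (U : seq T) : uniq U -> {subset ss <= U} ->
  (size (picks ss) <= \prod_(s <- U) size (X s) ^_ (count_mem s ss))%N.
Proof.
move=> uU; elim: ss => [|s ss IH] ssU; first by rewrite big1.
have {}IH : (size (picks ss) <= \prod_(t <- U) size (X t) ^_ (count_mem t ss))%N.
  by apply: IH => t tss; apply: ssU; rewrite inE tss orbT.
have sU : s \in U by apply: ssU; rewrite mem_head.
rewrite (bigD1_seq s)//= eqxx add1n ffactnSr.
rewrite (eq_bigr (fun t => size (X t) ^_ (count_mem t ss))); last first.
  by move=> t ts; rewrite eq_sym (negbTE ts).
rewrite mulnAC -(bigD1_seq s)//=.
apply: leq_trans (leq_mul IH (leqnn _)).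
rewrite size_allpairs_dep sumnE big_map big_seq.
rewrite -[X in (_ <= X * _)%N](size_map (fun=> 0%N)) -sum1_size big_map big_distrl/=.
rewrite [X in (_ <= X)%N]big_seq.
apply: leq_sum => ns; rewrite mem_picks => /and3P[/eqP sz un al].
rewrite mul1n.
set F := [seq n <- X s | _].
(* The indices already used for [s]. They are distinct, lie in [X s] and are disjoint from the
   admissible choices [F]. *)
pose V := [seq p.2 | p <- zip ss ns & p.1 == s].
have sV : size V = count_mem s ss.
  rewrite size_map size_filter -[in RHS](@unzip1_zip _ _ ss ns) ?sz// count_map.
  by apply: eq_count.
rewrite -sV leq_subRL; last first.
  apply: uniq_leq_size.
    rewrite map_inj_in_uniq ?filter_uniq// => -[a b] [a' b'].
    by rewrite !mem_filter/= => /andP[/eqP-> _] /andP[/eqP-> _] ->.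
  by move=> n /mapP[p]; rewrite mem_filter => /andP[/eqP<- /(allP al)] + ->.
rewrite -size_cat; apply: uniq_leq_size.
  rewrite cat_uniq filter_uniq// andbT map_inj_in_uniq ?filter_uniq//=; last first.
    move=> -[a b] [a' b'].
    by rewrite !mem_filter/= => /andP[/eqP-> _] /andP[/eqP-> _] ->.
  apply/hasPn => n; rewrite mem_filter => /andP[+ _]; apply: contra.
  by move=> /mapP[[a b]]; rewrite mem_filter => /andP[/eqP/= -> +] ->.
move=> n; rewrite mem_cat mem_filter => /orP[|/andP[]//].
by move=> /mapP[p]; rewrite mem_filter => /andP[/eqP<- /(allP al)] + ->.
Qed.

End distinct_picks.

Lemma poisson_pmf_series_cvg (R : realType) (r : R) : 0 < r ->
  series (poisson_pmf r) @ \oo --> (1 : R).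
Proof.
move=> r0; rewrite -(expRxMexpNx_1 r) mulrC.
have -> : series (poisson_pmf r) = expR (- r) \*o series (exp_coeff r).
  apply/funext => n; rewrite /series/= big_distrr/=; apply: eq_bigr => k _.
  by rewrite /poisson_pmf r0 mulrC.
by apply: cvgMr; exact: is_cvg_series_exp_coeff.
Qed.

Lemma poisson_partial_le1 (R : realType) (r : R) (M : nat) : 0 < r ->
  \sum_(k < M) poisson_pmf r k <= 1.
Proof.
move=> r0; rewrite -(big_mkord xpredT).
have c := poisson_pmf_series_cvg r0; rewrite -(cvg_lim _ c)//.
apply: (nondecreasing_cvgn_le (u_ := series (poisson_pmf r))).
  by apply/nondecreasing_seqP => n; rewrite /series/= big_nat_recr//= lerDl poisson_pmf_ge0.
by apply/cvg_ex; exists 1.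
Qed.

(** The factorial moment of a Poisson variable: terms with [k < m] vanish, and
    [k ^_ m / k! = 1 / (k - m)!] shifts the others to [r ^+ m] times the Poisson weights. The
    truncated form suits the cutoff on counts in the chain estimate. *)
Lemma poisson_partial_moment (R : realType) (r : R) (m M : nat) : 0 < r ->
  \sum_(k < M) (k ^_ m)%:R * poisson_pmf r k <= r ^+ m.
Proof.
move=> r0; rewrite -(big_mkord xpredT (fun k => (k ^_ m)%:R * poisson_pmf r k)).
have sum1 N : \sum_(0 <= k < N) poisson_pmf r k <= 1.
  by rewrite big_mkord poisson_partial_le1.
apply: le_trans (_ : \sum_(0 <= k < m + M) (k ^_ m)%:R * poisson_pmf r k <= _).
  rewrite (@big_cat_nat _ _ _ M 0 (m + M))//= ?leq_addl// lerDl.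
  by apply: sumr_ge0 => k _; rewrite mulr_ge0// poisson_pmf_ge0.
rewrite (@big_cat_nat _ _ _ m 0 (m + M))//= ?leq_addr// big_nat_cond big1 ?add0r; last first.
  by move=> k /andP[/andP[_ km] _]; rewrite ffact_small// mul0r.
rewrite -{1}[m]add0n big_addn addKn.
rewrite (eq_bigr (fun k => r ^+ m * poisson_pmf r k)); last first.
  move=> k _; rewrite /poisson_pmf r0 exprD !mulrA; congr (_ * _).
  have /(congr1 (fun n => n%:R : R)) := ffact_fact (leq_addl k m).
  rewrite addnK natrM => <-.
  by field; rewrite !pnatr_eq0 -!lt0n fact_gt0 ffact_gt0 leq_addl.
by rewrite -big_distrr/= ler_piMr// exprn_ge0// ltW.
Qed.

Lemma countable_bigcup_measurable d (T : sigmaRingType d) (I : countType)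
    (D : set I) (F : I -> set T) :
  (forall i, D i -> measurable (F i)) -> measurable (\bigcup_(i in D) F i).
Proof.
move=> mF; rewrite bigcup_mkcond; apply: countable_bigcupT_measurable => // i.
by case: ifPn => // /set_mem/mF.
Qed.

(** Splits over the countably many finite index sets. The space is kept general because the lemma is
    applied to the sigma-algebra generated by the arrivals at one site, in terms of which
    independence is stated. *)
Lemma measurable_card_eq d (T : measurableType d) (A : nat -> set T) (k : nat) :
  (forall n, measurable (A n)) ->
  measurable [set t | ([set n | A n t] #= `I_k)%card].
Proof.
move=> mA.
have -> : [set t | ([set n | A n t] #= `I_k)%card] =
    \bigcup_(F in [set F : {fset nat} | #|` F| = k])
      \bigcap_n (if n \in F then A n else ~` A n).
  apply/seteqP; split=> [t /= At|t [F /= cF AF]].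
    have fin : finite_set [set n | A n t] by apply/finite_setP; exists k.
    exists (fset_set [set n | A n t]); first exact: card_fset_set.
    move=> n _; rewrite in_fset_set//; case: ifPn => [/set_mem//|/negP nA].
    by move=> /mem_set.
  suff -> : [set n | A n t] = [set` F] by exact/card_eq_fsetP.
  apply/seteqP; split=> n /=.
    by move=> Ant; apply: contrapT => /negP nF; have := AF n I; rewrite (negbTE nF).
  by move=> nF; have := AF n I; rewrite nF.
apply: countable_bigcup_measurable => F _; apply: bigcap_measurable => // n _.
by case: ifPn => // _; exact: measurableC.
Qed.

Section arrival_counts.
Context {d : nat} {R : realType} {disp : measure_display}.
Context {Omega : measurableType disp} {P : probability Omega R} {lambda : R}.
Context {law : set (R * siteset d) -> \bar R}.
Variable H : poisson_hail P lambda law.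

Definition slot_event (w : site d) (i n : nat) : set Omega :=
  [set om | i%:R < arrival H w n om <= i.+1%:R].

Definition count_event (w : site d) (i k : nat) : set Omega :=
  [set om | ([set n | slot_event w i n om] #= `I_k)%card].

Lemma slot_event_sigma w i n : sigma_of_seq (arrival H w) (slot_event w i n).
Proof.
apply: sub_sigma_algebra; exists n => //.
exists `]i%:R, i.+1%:R]%classic; first exact: measurable_itv.
by rewrite setTI; apply/seteqP; split=> om; rewrite /= in_itv.
Qed.

Lemma count_event_sigma w i k : sigma_of_seq (arrival H w) (count_event w i k).
Proof.
apply: (@measurable_card_eq _
  (g_sigma_algebraType (\bigcup_n sigma_of (arrival H w n)))) => n.
exact: slot_event_sigma.
Qed.

Lemma sigma_of_seq_measurable w A :
  sigma_of_seq (arrival H w) A -> measurable A.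
Proof.
apply: smallest_sub; first exact: sigma_algebra_measurable.
move=> B [n _ [C mC <-]].
by have [mT _ _ _] := arrivalP H w; exact: mT.
Qed.

Lemma measurable_slot_event w i n : measurable (slot_event w i n).
Proof. by apply: (@sigma_of_seq_measurable w); exact: slot_event_sigma. Qed.

Lemma measurable_mark_event j (A : set (R * siteset d)) :
  measurable A -> measurable (mark H j.1 j.2 @^-1` A).
Proof. by move=> mA; rewrite -[X in measurable X]setTI; exact: measurable_mark. Qed.

Definition counts_event (W : {fset site d}) (q : nat) (k : site d -> nat -> nat) :=
  \bigcap_(w in [set` W]) \bigcap_(i in `I_q) count_event w i (k w i).

Lemma counts_event_sigma w q (k : nat -> nat) :
  sigma_of_seq (arrival H w) (\bigcap_(i in `I_q) count_event w i (k i)).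
Proof.
apply: (@bigcap_measurableType _ (g_sigma_algebraType (\bigcup_n sigma_of (arrival H w n)))).
by move=> i _; exact: count_event_sigma.
Qed.

Lemma measurable_counts_event W q k : measurable (counts_event W q k).
Proof.
apply: fin_bigcap_measurable => // w _.
by apply: (@sigma_of_seq_measurable w); exact: counts_event_sigma.
Qed.

(** Independence is used once, for the finite family consisting of the arrival processes of the
    sites in [W] and the marks of the jobs in [js]. Unit slots give every count the parameter
    [lambda]. *)
Lemma prob_counts_marks (W : {fset site d}) q k (js : seq (site d * nat))
    (A : site d * nat -> set (R * siteset d)) :
  uniq js -> (forall j, measurable (A j)) ->
  P (counts_event W q k `&` \bigcap_(j in [set` js]) (mark H j.1 j.2 @^-1` A j)) =
  ((\prod_(w <- W) \prod_(i < q) (poisson_pmf lambda (k w i))%:E) *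
   \prod_(j <- js) law (A j))%E.
Proof.
move=> ujs mA.
pose E (i : site d + site d * nat) : set Omega := match i with
  | inl w => \bigcap_(i in `I_q) count_event w i (k w i)
  | inr j => mark H j.1 j.2 @^-1` A j end.
pose s : seq (site d + site d * nat) := map inl (enum_fset W) ++ map inr js.
have us : uniq s.
  rewrite cat_uniq !map_inj_uniq; [|by move=> ? ? []..].
  rewrite fset_uniq ujs andbT/=; apply/hasPn => x /mapP[j _ ->].
  by apply/negP => /mapP[].
have perm : perm_eq (enum_fset [fset x in s]%fset) s.
  by apply: uniq_perm => // x; rewrite in_fset.
have mems x : [set` [fset x in s]%fset] x = (x \in s) :> Prop.
  by rewrite /= in_fset.
have := @independence _ _ _ _ _ _ _ H [fset x in s]%fset E.
have -> : \bigcap_(i in [set` [fset x in s]%fset]) E i =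
    counts_event W q k `&` \bigcap_(j in [set` js]) (mark H j.1 j.2 @^-1` A j).
  apply/seteqP; split=> [om h|om [h1 h2] [w|j]].
  - split=> [w wW|j jjs].
      by apply: (h (inl w)); rewrite mems mem_cat map_f.
    by apply: (h (inr j)); rewrite mems mem_cat orbC map_f.
  - rewrite mems mem_cat => /orP[/mapP[w' w'W [->]]|/mapP[]//]; exact: h1.
  - rewrite mems mem_cat => /orP[/mapP[]//|/mapP[j' j'W [->]]]; exact: h2.
move=> ->; last first.
  move=> [w|j] _ /=; first exact: counts_event_sigma.
  by exists (A j) => //; rewrite setTI.
rewrite (perm_big _ perm)/= big_cat/= !big_map; congr (_ * _)%E.
  apply: eq_bigr => w _; have [_ _ _ pois] := arrivalP H w.
  have := pois q (fun i => i%:R) (k w) (lexx 0).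
  rewrite /E => ->; last by move=> i _; rewrite ltr_nat.
  by apply: eq_bigr => i _; rewrite -natrB// subSnn mulr1.
by apply: eq_bigr => j _; rewrite /E; exact: (mark_law H j.1 j.2 (mA j)).
Qed.

End arrival_counts.

(** * Probability of a chain of jobs *)

Lemma measure_bigcup_seq_le d (T : measurableType d) (R : realType)
    (mu : {measure set T -> \bar R}) (I : choiceType) (s : seq I) (F : I -> set T) :
  (forall i, measurable (F i)) ->
  (mu (\bigcup_(i in [set` s]) F i) <= \sum_(i <- s) mu (F i))%E.
Proof.
move=> mF; elim: s => [|i s IH].
  by rewrite big_nil set_nil bigcup_set0 measure0.
rewrite big_cons bigcup_seq big_cons -bigcup_seq.
have mU : measurable (\bigcup_(i in [set` s]) F i).
  by rewrite bigcup_seq; exact: bigsetU_measurable.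
by apply: (le_trans (measureU2 mu (mF i) mU)); exact: leeD2l.
Qed.

Lemma zip_mapl (A B C : Type) (f : A -> B) (s : seq A) (t : seq C) :
  zip [seq f x | x <- s] t = [seq (f p.1, p.2) | p <- zip s t].
Proof. by elim: s t => [|x s IH] [|y t]//=; rewrite IH. Qed.

(* ((v, i), w) stands for a job arriving at the site w in the time slot
   ]i, i + 1] whose server set is located at v (see anchor). *)
Definition label (d : nat) := ((site d * nat) * site d)%type.

Section chain_event.
Context {d : nat} {R : realType} {disp : measure_display}.
Context {Omega : measurableType disp} {P : probability Omega R} {lambda : R}.
Context {law : set (R * siteset d) -> \bar R}.
Variable H : poisson_hail P lambda law.

Variables (G : label d -> set (R * siteset d)) (g : label d -> R).
Hypothesis mG : forall l, measurable (G l).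
Hypothesis lawG : forall l, law (G l) = (g l)%:E.
Hypothesis lambda_gt0 : 0 < lambda.

(** Only labels are prescribed; the indices of the jobs at their sites are existential. [uniq] makes
    the jobs pairwise distinct even where labels repeat. *)
Definition chain_event (ls : seq (label d)) : set Omega :=
  [set om | exists ns : seq nat, [/\ size ns = size ls,
    uniq (zip [seq l.2 | l <- ls] ns) &
    forall l n, (l, n) \in zip ls ns ->
      slot_event H l.2 l.1.2 n om /\ G l (mark H l.2 n om)]].

Lemma measurable_chain_event ls : measurable (chain_event ls).
Proof.
have -> : chain_event ls =
    \bigcup_(ns in [set ns | size ns = size ls /\ uniq (zip [seq l.2 | l <- ls] ns)])
    \bigcap_(p in [set` zip ls ns]) (slot_event H p.1.2 p.1.1.2 p.2 `&`
      (mark H p.1.2 p.2 @^-1` G p.1)).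
  apply/seteqP; split=> [om [ns [sz un h]]|om [ns [sz un] h]].
    by exists ns => // -[l n] /h.
  by exists ns; split=> // l n /h.
apply: countable_bigcup_measurable => ns _.
apply: fin_bigcap_measurable => // p _; apply: measurableI.
  exact: measurable_slot_event.
exact: (measurable_mark_event H (p.1.2, p.2)).
Qed.

Lemma law_weight_ge0 l : 0 <= g l.
Proof. by rewrite -lee_fin -lawG -(mark_law H 0 0 (mG l)); exact: (measure_ge0 P). Qed.

Section bound.
Variable ls : seq (label d).
Let W : {fset site d} := [fset l.2 | l in ls]%fset.
Let q := (\max_(l <- ls) l.1.2).+1.
Let S := (W * 'I_q)%type.
Let v (s : S) : site d * nat := (val s.1, val s.2).
Let ss := [seq (l.2, l.1.2) | l <- ls].
Let ws := [seq l.2 | l <- ls].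

Let v_inj : injective v.
Proof. by move=> [w i] [w' i'] [/val_inj-> /val_inj->]. Qed.

Let ss_range t : t \in ss -> exists s, t = v s.
Proof.
move=> /mapP[l lls ->].
have wW : l.2 \in W by apply/imfsetP; exists l.
have iq : (l.1.2 < q)%N.
  by rewrite /q ltnS (big_rem _ lls)/= leq_maxl.
by exists ([` wW]%fset, Ordinal iq).
Qed.

Let sum_count : (\sum_(s : S) count_mem (v s) ss = size ls)%N.
Proof.
rewrite -[RHS](size_map (fun l => (l.2, l.1.2))) -/ss.
have: {subset ss <= ss} by [].
elim: {1 3 4}ss => [|t r IH] sub; first by rewrite big1.
rewrite /= big_split/= IH; last by move=> x xr; rewrite sub// inE xr orbT.
have [|s ->] := @ss_range t; first by rewrite sub// mem_head.
rewrite (bigD1 s)//= eqxx big1 ?addn0// => s' ss'.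
by case: eqP => // /v_inj E; rewrite E eqxx in ss'.
Qed.

Section cutoff.
(** Cutting the counts at [M] makes the count functions a finite type, so that the sum over them is
    finite and distributes over the slots. *)
Variable M : nat.
Let K := {ffun S -> 'I_M}.
Let kf (kappa : K) (w : site d) (i : nat) : nat :=
  if insub w is Some w' then if insub i is Some i' then kappa (w', i') else 0%N
  else 0%N.
Let kfE kappa s : kf kappa (v s).1 (v s).2 = kappa s.
Proof. by rewrite /kf /v /= !valK; case: s. Qed.
Let X kappa (t : site d * nat) :=
  iota (\sum_(j < t.2) kf kappa t.1 j) (kf kappa t.1 t.2).
Let C kappa := counts_event H W q (kf kappa).
Let prodE (f : nat -> R) kappa :
  \prod_(w <- W) \prod_(i < q) f (kf kappa w i) = \prod_(s : S) f (kappa s).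
Proof.
rewrite big_seq_fsetE/= pair_big/=.
by apply: eq_bigr => s _; rewrite -(kfE kappa s).
Qed.

Let probC kappa :
  P (C kappa) = (\prod_(s : S) poisson_pmf lambda (kappa s))%:E.
Proof.
have := @prob_counts_marks _ _ _ _ _ _ _ H W q (kf kappa) [::]
  (fun=> set0) isT (fun=> measurable0).
rewrite set_nil bigcap_set0 setIT => ->.
rewrite big_nil mule1 -(prodE (poisson_pmf lambda)).
by rewrite -prodEFin; apply: eq_bigr => w _; rewrite -prodEFin.
Qed.

Let mC kappa : measurable (C kappa).
Proof. exact: measurable_counts_event. Qed.

(* Once the number of jobs in every slot is prescribed, the indices of the jobs
   of each slot are known, so that only the marks remain random. *)
Let chain_C kappa :
  (P (chain_event ls `&` C kappa) <=
    (\prod_(s : S) ((kappa s ^_ count_mem (v s) ss)%:R * poisson_pmf lambda (kappa s)) *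
     \prod_(l <- ls) g l)%:E)%E.
Proof.
pose l0 : label d := ((0, 0%N), 0).
(* The condition imposed on the mark of job [j] is that of the label at the position of [j]. As the
   pairs in [zip ws ns] are distinct, every job carries one condition only. *)
pose A (ns : seq nat) j := G (nth l0 ls (index j (zip ws ns))).
pose E ns := C kappa `&` \bigcap_(j in [set` zip ws ns]) (mark H j.1 j.2 @^-1` A ns j).
have mE ns : measurable (E ns).
  apply: measurableI => //; apply: fin_bigcap_measurable => // j _.
  by apply: measurable_mark_event; exact: mG.
(* [picks] enumerates the possible indices slot by slot; the filter provides distinctness as pairs
   of a site and an index, the form that independence of the marks requires. *)
pose L := [seq ns <- picks (X kappa) ss | uniq (zip ws ns)].
have sub : chain_event ls `&` C kappa `<=` \bigcup_(ns in [set` L]) E ns.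
  move=> om [[ns [sz un h]] Com]; exists ns => /=.
    rewrite mem_filter un mem_picks.
    rewrite size_map sz eqxx/= /ss; apply/andP; split.
      have wsE : ws = [seq t.1 | t <- ss] by rewrite -map_comp.
      move: un; rewrite -/ws wsE.
      by rewrite zip_mapl => /map_uniq.
    apply/allP => -[t n]; rewrite zip_mapl => /mapP[[l n'] lls [tE ->]].
    have [s sE] : exists s, t = v s.
      apply: ss_range; rewrite tE; apply/mapP; exists l => //.
      by have := map_f fst lls; rewrite -/unzip1 unzip1_zip// sz.
    have [+ _] := h _ _ lls.
    rewrite sE /v in tE; case: tE => <- <- /=.
    have [_ T0 T_incr _] := arrivalP H (val s.1).
    rewrite sE /X /v /=.
    apply: (@slot_indices _ (fun n => arrival H (val s.1) n om) q (kf kappa (val s.1))) => //.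
    by move=> i iq; apply: Com => //=; exact: valP.
  split=> // j jz; set i := index j (zip ws ns).
  have iz : (i < size ls)%N.
    by move: jz; rewrite /= -index_mem size_zip size_map sz minnn.
  have jE : j = ((nth l0 ls i).2, nth 0%N ns i).
    by rewrite -(nth_index (0, 0%N) jz) -/i nth_zip ?size_map ?sz// (nth_map l0).
  rewrite /= /A -/i jE /=.
  apply: proj2 (h (nth l0 ls i) (nth 0%N ns i) _).
  by rewrite -(nth_zip l0 0%N) ?mem_nth// size_zip sz minnn.
have PE ns : ns \in L -> P (E ns) =
    (\prod_(s : S) poisson_pmf lambda (kappa s) * \prod_(l <- ls) g l)%:E.
  rewrite mem_filter mem_picks.
  move=> /andP[un /and3P[/eqP sz _ _]]; rewrite size_map in sz.
  rewrite /E prob_counts_marks//; last by move=> j; exact: mG.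
  rewrite EFinM; congr (_ * _)%E.
    rewrite -(prodE (poisson_pmf lambda)).
    by rewrite -prodEFin; apply: eq_bigr => w _; rewrite -prodEFin.
  rewrite (big_nth (0, 0%N)) -prodEFin (big_nth l0).
  rewrite size_zip size_map sz minnn; apply: eq_big_nat => i /andP[_ ils].
  by rewrite /A index_uniq// ?lawG// size_zip size_map sz minnn.
apply: (@le_trans _ _ (\sum_(ns <- L) P (E ns))%E).
  apply: le_trans (measure_bigcup_seq_le _ _ _) => //.
  apply: le_measure => //; rewrite ?inE.
    by apply: measurableI => //; exact: measurable_chain_event.
  by rewrite bigcup_seq; exact: bigsetU_measurable.
rewrite big_seq (eq_bigr (fun=> (\prod_(s : S) poisson_pmf lambda (kappa s) *
  \prod_(l <- ls) g l)%:E)); last exact: PE.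
rewrite -big_seq sumEFin lee_fin big_const_seq count_predT iter_addr_0.
rewrite big_split/= -natr_prod -[leLHS]mulr_natl mulrA.
rewrite !ler_wpM2r//.
- by apply: prodr_ge0 => l _; exact: law_weight_ge0.
- by apply: prodr_ge0 => s _; exact: poisson_pmf_ge0.
rewrite ler_nat (leq_trans (size_subseq (filter_subseq _ _)))//.
have uU : uniq [seq v s | s : S] by rewrite map_inj_uniq// enum_uniq.
have := @size_picks _ (X kappa) (fun t => iota_uniq _ _) ss _ uU.
rewrite big_image/= => /(_ _)/leq_trans; apply.
  by move=> t /ss_range[s ->]; apply/mapP; exists s => //; rewrite mem_enum.
by apply: leq_prod => s _; rewrite size_iota kfE.
Qed.

Let trivC : trivIset [set` index_enum K] C.
Proof.
move=> kappa kappa' _ _ [om [Ck Ck']]; apply/ffunP => s; apply/val_inj => /=.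
have := Ck (val s.1) (valP s.1) s.2 (ltn_ord s.2).
have := Ck' (val s.1) (valP s.1) s.2 (ltn_ord s.2).
rewrite !kfE /count_event /= => c1 c2.
by apply/card_eq_II; rewrite -(card_eql c2).
Qed.

Let sum_prod (f : S -> nat -> R) :
  \sum_(kappa : K) \prod_(s : S) f s (kappa s) = \prod_(s : S) \sum_(k < M) f s k.
Proof. by rewrite bigA_distr_bigA. Qed.

Let probU : P (\bigcup_(kappa in [set` index_enum K]) C kappa) =
  ((\sum_(k < M) poisson_pmf lambda k) ^+ #|{: S}|)%:E.
Proof.
rewrite measure_fin_bigcup//.
rewrite -fsbig_seq ?index_enum_uniq// (eq_bigr _ (fun kappa _ => probC kappa)).
by rewrite sumEFin (sum_prod (fun=> poisson_pmf lambda)) prodr_const.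
Qed.

(** The first term is the probability that some slot holds [M] jobs or more. On the complement,
    summing over the count functions gives a product over slots of truncated factorial moments,
    hence one factor [lambda] per label. *)
Lemma prob_chain_cutoff : (P (chain_event ls) <=
  (1 - (\sum_(k < M) poisson_pmf lambda k) ^+ #|{: S}| +
   \prod_(l <- ls) (lambda * g l))%:E)%E.
Proof.
set U := \bigcup_(kappa in [set` index_enum K]) C kappa.
have mU : measurable U by apply: fin_bigcup_measurable.
have mch := measurable_chain_event ls.
have mchC kappa : measurable (chain_event ls `&` C kappa) by exact: measurableI.
have -> : chain_event ls = (chain_event ls `\` U) `|`
    \bigcup_(kappa in [set` index_enum K]) (chain_event ls `&` C kappa).
  by rewrite -setI_bigcupr setUC setUIDK.
have mD := measurableD mch mU.
have mB : measurable (\bigcup_(kappa in [set` index_enum K]) (chain_event ls `&` C kappa)).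
  exact: fin_bigcup_measurable.
apply: (le_trans (measureU2 P mD mB)).
rewrite EFinD; apply: leeD.
  rewrite EFinB -probU -probability_setC//; apply: le_measure; rewrite ?inE//.
  exact: measurableC.
apply: le_trans (measure_bigcup_seq_le _ _ _) _ => //.
apply: le_trans (lee_sum _ (fun kappa _ => chain_C kappa)) _.
rewrite sumEFin lee_fin -big_distrl/=.
rewrite (sum_prod (fun s k => (k ^_ count_mem (v s) ss)%:R * poisson_pmf lambda k)).
rewrite big_split/= ler_wpM2r//.
  by apply: prodr_ge0 => l _; exact: law_weight_ge0.
rewrite big_const_seq count_predT iter_mulr_1 -sum_count -prodrXr.
apply: ler_prod => s _; rewrite poisson_partial_moment// andbT.
by apply: sumr_ge0 => k _; rewrite mulr_ge0// poisson_pmf_ge0.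
Qed.

End cutoff.

(** The cutoff [M] tends to infinity; the partial sums of the Poisson law tend to 1. *)
Lemma prob_chain_event :
  (P (chain_event ls) <= (\prod_(l <- ls) (lambda * g l))%:E)%E.
Proof.
rewrite -(fineK (fin_num_measure P _ (measurable_chain_event ls))) lee_fin.
have cv : 1 - series (poisson_pmf lambda) n ^+ #|{: S}| @[n --> \oo] -->
    1 - (1 : R) ^+ #|{: S}|.
  apply: cvgB; first exact: cvg_cst.
  elim: #|{: S}| => [|m IH]; first by rewrite expr0; exact: cvg_cst.
  rewrite exprS; under eq_fun do rewrite exprS.
  by apply: cvgM IH; exact: poisson_pmf_series_cvg.
rewrite expr1n subrr in cv.
have {}cv : 1 - series (poisson_pmf lambda) n ^+ #|{: S}| +
    \prod_(l <- ls) (lambda * g l) @[n --> \oo] -->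
  0 + \prod_(l <- ls) (lambda * g l) by apply: cvgD cv _; exact: cvg_cst.
rewrite -[leRHS]add0r -(cvg_lim _ cv)//.
apply: limr_ge; first by apply/cvg_ex; eexists; exact: cv.
apply: nearW => n; rewrite -lee_fin (fineK (fin_num_measure P _ (measurable_chain_event ls))).
by rewrite /series/= big_mkord; exact: prob_chain_cutoff.
Qed.

End bound.
End chain_event.

(** * Summation over chains *)

Lemma ler_sum_subseq (R : numDomainType) (I : eqType) (s1 s2 : seq I) (F : I -> R) :
  uniq s1 -> {subset s1 <= s2} -> (forall i, 0 <= F i) ->
  \sum_(i <- s1) F i <= \sum_(i <- s2) F i.
Proof.
move=> + + F0; elim: s1 s2 => [|x s1 IH] s2 /=.
  by move=> _ _; rewrite big_nil sumr_ge0.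
move=> /andP[xs us] sub; have xs2 : x \in s2 by apply: sub; rewrite mem_head.
rewrite big_cons (big_rem _ xs2)/= lerD2l; apply: IH => // y ys.
have := sub y; rewrite inE ys orbT => /(_ isT).
rewrite (perm_mem (perm_to_rem xs2)) inE => /orP[/eqP yx|//].
by rewrite -yx ys in xs.
Qed.

(** Countable subadditivity in terms of finite duplicate-free lists, so that the later sums over
    chains stay finite sums of reals. *)
Lemma measure_bigcup_le d (T : measurableType d) (R : realType)
    (mu : {measure set T -> \bar R}) (I : countType) (D : set I)
    (F : I -> set T) (c : \bar R) :
  (forall i, measurable (F i)) ->
  (forall s : seq I, uniq s -> (forall i, i \in s -> D i) ->
    (\sum_(i <- s) mu (F i) <= c)%E) ->
  (mu (\bigcup_(i in D) F i) <= c)%E.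
Proof.
move=> mF sumF.
pose E n : set T := if @pickle_inv I n is Some i then
  (if `[< D i >] then F i else set0) else set0.
have mE n : measurable (E n).
  by rewrite /E; case: pickle_inv => // i; case: ifP.
have -> : \bigcup_(i in D) F i = \bigcup_n E n.
  apply/seteqP; split=> [x [i Di Fx]|x [n _]]; rewrite /E.
    by exists (@choice.pickle I i) => //; rewrite pickleK_inv asboolT.
  by case: pickle_inv => // i; case: asboolP => // Di Fx; exists i.
have mU : measurable (\bigcup_n E n) by exact: bigcupT_measurable.
have sub : \bigcup_n E n `<=` \bigcup_n E n by [].
have := @measure_sigma_subadditive _ _ _ mu (\bigcup_n E n) E mE mU sub.
move=> /le_trans; apply.
apply: lime_le; first exact: is_cvg_nneseries.
apply: nearW => N.
pose s := [seq i <- pmap (@pickle_inv I) (iota 0 N) | `[< D i >]].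
have -> : (\sum_(0 <= n < N) mu (E n) = \sum_(i <- s) mu (F i))%E.
  rewrite /index_iota subn0 /s; elim: (iota 0 N) => [|n r IH]; first by rewrite !big_nil.
  rewrite big_cons IH /=; rewrite {1}/E.
  case: pickle_inv => [i|]/=; last by rewrite measure0 add0e.
  by case: ifP => _; rewrite ?big_cons// measure0 add0e.
apply: sumF; last by move=> i; rewrite mem_filter => /andP[/asboolP].
by rewrite filter_uniq// (@pmap_uniq _ _ _ _ (@pickle_invK I))// iota_uniq.
Qed.

Lemma sum_geometric_le (R : realFieldType) (x : R) (n : nat) : 0 <= x < 1 ->
  \sum_(i < n) x ^+ i <= (1 - x)^-1.
Proof.
move=> /andP[x0 x1]; rewrite -[(1 - x)^-1]mul1r ler_pdivlMr ?subr_gt0// mulrC.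
by rewrite -[1 - x]opprB mulNr -subrX1 opprB lerBlDr lerDl exprn_ge0.
Qed.

Section lattice_weights.
Context {d : nat}.

Definition nrm1 (v : site d) : nat := (\sum_(i < d) `|v ord0 i|)%N.

Definition pdist (p p' : site d * nat) : nat :=
  (nrm1 (p.1 - p'.1)%R + `|(p.2%:Z - p'.2%:Z)%R|)%N.

Fixpoint clen (p : site d * nat) (s : seq (site d * nat)) : nat :=
  if s is p' :: s' then (pdist p p' + clen p' s')%N else 0%N.

(** The weight of a point factors over its d + 1 space-time coordinates, and each coordinate
    contributes at most a two-sided geometric series. *)
Lemma sum_pdist_le (R : realFieldType) (x : R) (p : site d * nat)
    (s : seq (site d * nat)) : 0 < x < 1 -> uniq s ->
  \sum_(p' <- s) x ^+ pdist p p' <= (2 / (1 - x)) ^+ d.+1.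
Proof.
move=> /andP[x0 x1] us.
(* A crude bound on all distances in [s]: coordinate differences then lie in [[-N, N]] and become,
   shifted by [N], elements of the finite type ['I_M] with [M = 2 N + 1]. *)
pose N := (\sum_(p' <- s) pdist p p')%N.
have leN p' : p' \in s -> (pdist p p' <= N)%N.
  by move=> p's; rewrite /N (big_rem _ p's)/= leq_addr.
pose M := N.*2.+1.
pose e (z : int) : 'I_M := inord `|(z + N%:Z)%R|.
have eE z : (`|z| <= N)%N -> (`|(e z)%:Z - N%:Z| = `|z|)%N.
  by move=> zN; rewrite /e inordK /M; lia.
pose h (b : {ffun 'I_d -> 'I_M} * 'I_M) : R :=
  (\prod_c x ^+ `|(b.1 c)%:Z - N%:Z|) * x ^+ `|b.2%:Z - N%:Z|.
pose phi (p' : site d * nat) : {ffun 'I_d -> 'I_M} * 'I_M :=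
  ([ffun c => e ((p.1 - p'.1) ord0 c)], e (p.2%:Z - p'.2%:Z)).
have coordN p' c : p' \in s -> (`|(p.1 - p'.1)%R ord0 c| <= N)%N.
  move=> /leN; apply: leq_trans; rewrite /pdist /nrm1 (bigD1 c)//= -addnA.
  exact: leq_addr.
have timeN p' : p' \in s -> (`|(p.2%:Z - p'.2%:Z)%R| <= N)%N.
  by move=> /leN; apply: leq_trans; exact: leq_addl.
have hE p' : p' \in s -> x ^+ pdist p p' = h (phi p').
  move=> p's; rewrite /h /phi/= eE ?timeN// exprD; congr (_ * _).
  rewrite /nrm1 -prodrXr; apply: eq_bigr => c _.
  by rewrite ffunE eE// coordN.
have e_inj z z' : (`|z| <= N)%N -> (`|z'| <= N)%N -> e z = e z' -> z = z'.
  move=> zN z'N /(congr1 val) /=; rewrite !inordK /M; lia.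
have h0 b : 0 <= h b.
  by rewrite mulr_ge0 ?exprn_ge0 ?(ltW x0)// prodr_ge0// => c _; rewrite exprn_ge0// ltW.
rewrite big_seq (eq_bigr _ hE) -big_seq.
rewrite -(big_map phi xpredT h).
apply: (@le_trans _ _ (\sum_b h b)).
  apply: ler_sum_subseq => //.
  rewrite map_inj_in_uniq// => -[v i] [v' i'] ps ps' [/ffunP E1 E2].
  congr (_, _).
    apply/rowP => c; have := E1 c; rewrite !ffunE => /e_inj.
    move=> /(_ (coordN (v, i) c ps) (coordN (v', i') c ps')) /=.
    by rewrite !mxE => /addrI/oppr_inj.
  - have := e_inj _ _ (timeN _ ps) (timeN _ ps') E2; rewrite /=; lia.
  - by move=> b _; rewrite mem_index_enum.
have line : \sum_(a < M) x ^+ `|a%:Z - N%:Z| <= 2 / (1 - x).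
  have x01 : 0 <= x < 1 by rewrite ltW.
  rewrite -(big_mkord xpredT (fun a : nat => x ^+ `|a%:Z - N%:Z|)).
  rewrite (@big_cat_nat _ _ _ N)//=; last by rewrite /M; lia.
  rewrite mulr_natl mulr2n; apply: lerD.
    apply: le_trans (sum_geometric_le N x01).
    rewrite big_nat_rev/= -(big_mkord xpredT (fun i => x ^+ i)) !big_nat.
    apply: ler_sum => i iN; apply: ler_wiXn2l; [exact: ltW|exact: ltW|lia].
  apply: le_trans (sum_geometric_le N.+1 x01).
  rewrite -{1}[N]add0n big_addn -(big_mkord xpredT (fun i => x ^+ i)).
  have -> : (M - N = N.+1)%N by rewrite /M; lia.
  by apply: ler_sum => i _; apply: ler_wiXn2l; [exact: ltW|exact: ltW|lia].
rewrite -(pair_bigA _ (fun (b1 : {ffun 'I_d -> 'I_M}) (b2 : 'I_M) =>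
  (\prod_c x ^+ `|(b1 c)%:Z - N%:Z|) * x ^+ `|b2%:Z - N%:Z|))/=.
under eq_bigr do rewrite -big_distrr/=.
rewrite -big_distrl/= exprS mulrC.
apply: ler_pM => //.
- by apply: sumr_ge0 => a _; rewrite exprn_ge0// ltW.
- by apply: sumr_ge0 => b _; apply: prodr_ge0 => c _; rewrite exprn_ge0// ltW.
rewrite -(bigA_distr_bigA (fun (c : 'I_d) (a : 'I_M) => x ^+ `|a%:Z - N%:Z|)).
rewrite big_const_ord iter_mulr_1 lerXn2r// nnegrE.
  by apply: sumr_ge0 => a _; rewrite exprn_ge0// ltW.
by rewrite divr_ge0// subr_ge0 ltW.
Qed.

End lattice_weights.

Section chain_union.
Context {d : nat} {R : realType} {disp : measure_display}.
Context {Omega : measurableType disp} {P : probability Omega R} {lambda : R}.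
Context {law : set (R * siteset d) -> \bar R}.
Variable H : poisson_hail P lambda law.
Variables (G : label d -> set (R * siteset d)) (g : label d -> R).
Hypothesis mG : forall l, measurable (G l).
Hypothesis lawG : forall l, law (G l) = (g l)%:E.
Hypothesis lambda_gt0 : 0 < lambda.
Variables (q x : R).
Hypothesis x01 : 0 < x < 1.
Hypothesis sum_g : forall p (s : seq (site d)), uniq s ->
  \sum_(w <- s) g (p, w) <= q.

Let g0 l : 0 <= g l.
Proof. exact: (law_weight_ge0 H mG lawG). Qed.

Let kappa := lambda * q * (2 / (1 - x)) ^+ d.+1.

Let q0 : 0 <= q.
Proof. by have := sum_g (0, 0%N) (isT : uniq [::]); rewrite big_nil. Qed.

Let sum_label (p : site d * nat) (s : seq (label d)) : uniq s ->
  \sum_(l <- s) lambda * g l * x ^+ pdist p l.1 <= kappa.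
Proof.
move=> us; have x0 : 0 <= x by case/andP: x01 => /ltW.
pose ps := undup [seq l.1 | l <- s]; pose ws := undup [seq l.2 | l <- s].
apply: (@le_trans _ _ (\sum_(l <- [seq (p', w) | p' <- ps, w <- ws])
    lambda * g l * x ^+ pdist p l.1)).
  apply: ler_sum_subseq => // [l ls|l].
    apply/allpairsP; exists l; rewrite /ps /ws !mem_undup.
    by split; [exact: map_f|exact: map_f|case: l {ls}].
  by rewrite mulr_ge0 ?exprn_ge0// mulr_ge0// ltW.
rewrite big_allpairs_dep/=.
apply: (@le_trans _ _ (\sum_(p' <- ps) lambda * q * x ^+ pdist p p')).
  apply: ler_sum => p' _; rewrite -big_distrl/= ler_wpM2r ?exprn_ge0//.
  by rewrite -big_distrr/= ler_wpM2l ?(ltW lambda_gt0)// sum_g// undup_uniq.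
rewrite -big_distrr/= ler_wpM2l ?mulr_ge0 ?(ltW lambda_gt0)//.
by apply: sum_pdist_le => //; exact: undup_uniq.
Qed.

Let weight (p : site d * nat) (ls : seq (label d)) :=
  \prod_(l <- ls) (lambda * g l) * x ^+ clen p [seq l.1 | l <- ls].

(** A finite family of chains is contained in the product of its heads and its tails. Summing over
    the tails first, with a bound uniform in the starting point, gives one factor [kappa] per
    link. *)
Let sum_chain m p (s : seq (seq (label d))) : uniq s ->
  (forall ls, ls \in s -> size ls = m) -> \sum_(ls <- s) weight p ls <= kappa ^+ m.
Proof.
have x0 : 0 <= x by case/andP: x01 => /ltW.
have weight0 p' ls : 0 <= weight p' ls.
  rewrite mulr_ge0 ?exprn_ge0// prodr_ge0// => l _.
  by rewrite mulr_ge0// ltW.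
elim: m p s => [|m IH] p s us sz.
  apply: (@le_trans _ _ (\sum_(ls <- [:: [::]]) weight p ls)).
    by apply: ler_sum_subseq => // ls /sz/size0nil ->; rewrite mem_head.
  by rewrite big_seq1 /weight big_nil mul1r expr0.
pose l0 : label d := ((0, 0%N), 0).
pose hs := undup [seq head l0 ls | ls <- s].
pose ts := undup [seq behead ls | ls <- s].
apply: (@le_trans _ _ (\sum_(ls <- [seq l :: t | l <- hs, t <- ts]) weight p ls)).
  apply: ler_sum_subseq => // ls lss; apply/allpairsP.
  exists (head l0 ls, behead ls); split; rewrite /= ?mem_undup.
  - exact: (map_f (head l0)).
  - exact: (map_f behead).
  by have := sz _ lss; case: (ls).
rewrite big_allpairs_dep/=.
have -> : \sum_(l <- hs) \sum_(t <- ts) weight p (l :: t) =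
    \sum_(l <- hs) (lambda * g l * x ^+ pdist p l.1) * \sum_(t <- ts) weight l.1 t.
  apply: eq_bigr => l _; rewrite big_distrr/=; apply: eq_bigr => t _.
  by rewrite /weight big_cons/= exprD mulrACA.
apply: (@le_trans _ _ (\sum_(l <- hs) (lambda * g l * x ^+ pdist p l.1) * kappa ^+ m)).
  apply: ler_sum => l _; rewrite ler_wpM2l ?mulr_ge0 ?exprn_ge0 ?(ltW lambda_gt0)//.
  apply: IH; first exact: undup_uniq.
  by move=> t; rewrite mem_undup => /mapP[ls /sz + ->]; rewrite size_behead => ->.
rewrite -big_distrl/= exprS ler_wpM2r//; last by rewrite sum_label// undup_uniq.
rewrite exprn_ge0// !mulr_ge0 ?(ltW lambda_gt0)// exprn_ge0// divr_ge0// subr_ge0.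
by case/andP: x01 => _ /ltW.
Qed.

(** An exponential Markov bound: for chains of length at most [A] the factor [x ^- A * x ^+ clen] is
    at least 1. *)
Lemma prob_chains (p : site d * nat) (m A : nat) :
  (P (\bigcup_(ls in [set ls | size ls = m /\ (clen p [seq l.1 | l <- ls] <= A)%N])
      chain_event H G ls) <=
   (x ^- A * (lambda * q * (2 / (1 - x)) ^+ d.+1) ^+ m)%:E)%E.
Proof.
have /andP[x0 x1] := x01.
apply: measure_bigcup_le => [ls|s us sD]; first exact: measurable_chain_event.
apply: (@le_trans _ _ (\sum_(ls <- s) (x ^- A * weight p ls)%:E)%E).
  rewrite !big_seq; apply: lee_sum => ls /sD[_ cA].
  apply: (le_trans (prob_chain_event H mG lawG lambda_gt0 ls)).
  rewrite lee_fin /weight mulrCA ler_peMr//.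
    by apply: prodr_ge0 => l _; rewrite mulr_ge0// ltW.
  rewrite mulrC ler_pdivlMr ?exprn_gt0// mul1r ler_wiXn2l// ltW//.
rewrite sumEFin lee_fin -big_distrr/= ler_wpM2l ?invr_ge0 ?exprn_ge0 ?(ltW x0)//.
by apply: sum_chain => // ls /sD[].
Qed.

End chain_union.

(** * Chains extracted from a path *)

Section nrm1_theory.
Context {d : nat}.
Implicit Types x y z : site d.

Lemma nrm1C x y : nrm1 (x - y) = nrm1 (y - x).
Proof. by apply: eq_bigr => i _; rewrite !mxE distnC. Qed.

Lemma nrm1xx x : nrm1 (x - x) = 0%N.
Proof. by rewrite subrr; apply: big1 => i _; rewrite mxE. Qed.

Lemma nrm1_triangle x y z : (nrm1 (x - z) <= nrm1 (x - y) + nrm1 (y - z))%N.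
Proof.
rewrite /nrm1 -big_split/=; apply: leq_sum => i _; rewrite !mxE.
exact: leqD_dist.
Qed.

Lemma nrm1_telescope (h : nat -> site d) (m n : nat) : (m <= n)%N ->
  (nrm1 (h n - h m) <= \sum_(m <= a < n) nrm1 (h a.+1 - h a))%N.
Proof.
elim: n => [|n IH]; first by rewrite leqn0 => /eqP->; rewrite nrm1xx.
rewrite leq_eqVlt => /orP[/eqP->|]; first by rewrite nrm1xx.
rewrite ltnS => mn; rewrite big_nat_recr//= addnC.
by apply: (leq_trans (nrm1_triangle _ (h n) _)); rewrite leq_add2l IH.
Qed.

End nrm1_theory.

Section path_bound.
Context {R : realType} {d : nat}.
Variable c : configuration R d.
Local Notation job := (site d * nat)%type.
Variables (pos : job -> site d) (cl slot : job -> nat).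
Hypothesis d_gt0 : (0 < d)%N.
Hypothesis near_pos : forall j y, y \in servers c j ->
  (nrm1 (y - pos j)%R <= d * 2 ^ cl j)%N.
Hypothesis servers_diam : forall j y z, y \in servers c j -> z \in servers c j ->
  (nrm1 (y - z)%R <= d * 2 ^ cl j)%N.
Hypothesis service_le : forall j, service c j <= (2 ^ cl j)%:R.
Hypothesis slotP : forall j, (slot j)%:R < time c j <= (slot j).+1%:R.

Definition touched (u t : R) (g : R -> site d) (j : job) :=
  u < time c j <= t /\ g (time c j) \in servers c j.

Section variation.
Variables (u t : R) (g : R -> site d) (n : nat) (s : nat -> R).
Hypothesis s0 : s 0%N = u.
Hypothesis sn : s n = t.
Hypothesis s_incr : forall i, (i < n)%N -> s i < s i.+1.
Hypothesis g_const : forall i r, (i < n)%N -> s i <= r < s i.+1 -> g r = g (s i).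

Let jump i : R := (nrm1 (g (s i.+1) - g (s i)))%:R.

Definition variation (r : R) : R := \sum_(i < n | s i.+1 <= r) jump i.

Lemma step_times_mono i j : (i <= j)%N -> (j <= n)%N -> s i <= s j.
Proof.
move=> ij; rewrite -(subnKC ij); elim: (j - i)%N => [|m IH]; first by rewrite addn0.
rewrite addnS => lt; apply: (le_trans (IH (ltnW lt))); exact/ltW/s_incr.
Qed.

Lemma locate r : u <= r <= t -> exists i, [/\ (i <= n)%N, s i <= r,
  g r = g (s i) & forall a, (a < n)%N -> (s a.+1 <= r) = (a < i)%N].
Proof.
move=> /andP[ur rt].
pose p i := (i <= n)%N && (s i <= r).
have ex : exists i, p i by exists 0%N; rewrite /p s0 ur.
have bnd i : p i -> (i <= n)%N by case/andP.
have [i /andP[i_n sir] imax] := ex_maxnP ex bnd.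
exists i; split=> //.
  move: i_n; rewrite leq_eqVlt => /orP[/eqP iE|i_n].
    by congr g; apply/eqP; rewrite eq_le sir iE sn rt.
  apply: g_const => //; rewrite sir/= ltNge; apply/negP => h.
  by have := imax i.+1; rewrite /p i_n h ltnn => /(_ isT).
move=> a an; apply/idP/idP => [h|ai]; first by apply: imax; rewrite /p an.
exact: le_trans (step_times_mono ai i_n) sir.
Qed.

Lemma variation_bound r1 r : u <= r1 -> r1 <= r -> r <= t ->
  (nrm1 (g r - g r1))%:R <= variation r - variation r1.
Proof.
move=> ur1 r1r rt.
have [i [i_n sir gi vi]] : exists i, [/\ (i <= n)%N, s i <= r,
  g r = g (s i) & forall a, (a < n)%N -> (s a.+1 <= r) = (a < i)%N].
  by apply: locate; rewrite (le_trans ur1 r1r).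
have [i1 [i1_n si1r gi1 vi1]] : exists i, [/\ (i <= n)%N, s i <= r1,
  g r1 = g (s i) & forall a, (a < n)%N -> (s a.+1 <= r1) = (a < i)%N].
  by apply: locate; rewrite ur1 (le_trans r1r).
have varE r' i' : (i' <= n)%N -> (forall a, (a < n)%N -> (s a.+1 <= r') = (a < i')%N) ->
    variation r' = \sum_(0 <= a < i') jump a.
  move=> i'n h; rewrite big_mkord (big_ord_widen n)//.
  by apply: eq_bigl => a; rewrite h.
have i1i : (i1 <= i)%N.
  case: (i1) (i1_n) (si1r) => // a an sa1; rewrite -vi//; exact: le_trans r1r.
rewrite (varE r i)// (varE r1 i1)// (@big_cat_nat _ _ _ i1 0 i)//= addrAC subrr add0r.
by rewrite -natr_sum ler_nat gi gi1; exact: (nrm1_telescope (fun a => g (s a))).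
Qed.

Lemma variation_start : variation u = 0.
Proof.
apply: big1 => i; rewrite -s0 leNgt => /negP[].
apply: (@le_lt_trans _ _ (s i)); last exact: s_incr.
by apply: step_times_mono => //; exact/ltnW.
Qed.

Lemma variation_endE : variation t = \sum_(i < n) jump i.
Proof.
by apply: eq_bigl => i; rewrite -sn; apply/idP; exact: step_times_mono.
Qed.

Hypothesis jumpP : forall r y, u < r <= t -> (\forall r' \near r^'-, g r' = y) ->
  g r <> y -> exists j : job, [/\ time c j = r, g r \in servers c j & y \in servers c j].

Lemma jump_job i : (i < n)%N -> g (s i.+1) <> g (s i) ->
  exists j, [/\ time c j = s i.+1, g (s i.+1) \in servers c j & g (s i) \in servers c j].
Proof.
move=> i_n gi; apply: jumpP => //.
  rewrite -{1}s0 -sn (le_lt_trans (step_times_mono (leq0n i) (ltnW i_n))) ?s_incr//.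
  exact: step_times_mono.
near=> r'; apply: g_const => //; apply/andP; split=> //.
near: r'; exact/nbhs_left_ge/s_incr.
Unshelve. all: by end_near.
Qed.

(** Jumps at different times use different jobs, and both ends of a jump lie in the server set of
    its job. The length of the jumps is thus paid for by the sizes of touched jobs. *)
Lemma variation_jobs : exists js : seq job, [/\ uniq js,
  forall j, j \in js -> touched u t g j &
  variation t <= \sum_(j <- js) (d * 2 ^ cl j)%:R].
Proof.
pose I := [seq i <- iota 0 n | g (s i.+1) != g (s i)].
have ex i : exists j, i \in I ->
    [/\ time c j = s i.+1, g (s i.+1) \in servers c j & g (s i) \in servers c j].
  have [iI|] := boolP (i \in I); last by exists (0, 0%N).
  move: iI; rewrite mem_filter mem_iota => /andP[/eqP gi i_n].
  by have [j hj] := jump_job i_n gi; exists j.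
have [jf jfP] := choice ex.
have In i : i \in I -> (i < n)%N by rewrite mem_filter mem_iota => /andP[].
exists [seq jf i | i <- I]; split.
- rewrite map_inj_in_uniq ?filter_uniq ?iota_uniq// => i i' iI i'I E.
  have [ti _ _] := jfP _ iI; have [ti' _ _] := jfP _ i'I.
  rewrite E ti' in ti; apply/eqP; case: ltngtP => // lt; exfalso.
    have := step_times_mono (i := i.+1) (j := i') lt (ltnW (In _ i'I)).
    by rewrite leNgt -ti s_incr// In.
  have := step_times_mono (i := i'.+1) (j := i) lt (ltnW (In _ iI)).
  by rewrite leNgt ti s_incr// In.
- move=> _ /mapP[i iI ->]; have [ti gi _] := jfP _ iI; split; rewrite ti//.
  have i_n := In _ iI; rewrite -{1}s0 -sn.
  rewrite (le_lt_trans (step_times_mono (leq0n i) (ltnW i_n))) ?s_incr//.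
  exact: step_times_mono.
- have -> : variation t = \sum_(i <- I) jump i.
    rewrite variation_endE big_filter -(big_mkord xpredT jump) /index_iota subn0.
    rewrite (bigID (fun i => g (s i.+1) != g (s i)))/= [X in _ + X]big1 ?addr0//.
    by move=> i /negbNE/eqP E; rewrite /jump E nrm1xx.
  rewrite big_map [leLHS]big_seq [leRHS]big_seq; apply: ler_sum => i iI.
  by have [_ g1 g0] := jfP _ iI; rewrite ler_nat servers_diam.
Qed.

End variation.

Section chain_of_path.
Variables (u t : R) (g : R -> site d) (v : R -> R).
Hypothesis v_bound : forall r1 r, u <= r1 -> r1 <= r -> r <= t ->
  (nrm1 (g r - g r1))%:R <= v r - v r1.

(** The jobs are followed backwards in time, [e] being the current distance from the chain to the
    path. Each job costs [d * 2 ^ k] for going from the path to its position, as much for the way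
    back, and 1 for rounding its time to a slot. *)
Lemma clen_sorted (k : nat) (js : seq job) (p : site d) (i e : nat) (r : R) :
  (forall j, j \in js -> touched u t g j /\ cl j = k) ->
  path (fun r r' => r' <= r) r [seq time c j | j <- js] ->
  r <= t -> u <= r -> i%:R <= r <= i.+1%:R -> (nrm1 (p - g r)%R <= e)%N ->
  (clen (p, i) [seq (pos j, slot j) | j <- js])%:R <=
    (r - u) + (v r - v u) + e%:R + (size js * (2 * (d * 2 ^ k) + 1))%:R.
Proof.
elim: js p i e r => [|j js IH] p i e r tch /=.
  move=> _ rt ur _ _; rewrite mul0n addr0 addr_ge0// addr_ge0 ?subr_ge0//.
  by rewrite -subr_ge0; apply: le_trans (v_bound _ ur rt); rewrite ?ler0n.
move=> /andP[jr sorted_js] rt ur /andP[ir ri] pe.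
have [[/andP[uj jt] gj] clj] : touched u t g j /\ cl j = k by apply: tch; rewrite mem_head.
have {}IH := IH (pos j) (slot j) (d * 2 ^ k)%N (time c j).
have {}IH : (clen (pos j, slot j) [seq (pos j, slot j) | j <- js])%:R <=
    time c j - u + (v (time c j) - v u) + (d * 2 ^ k)%:R +
      (size js * (2 * (d * 2 ^ k) + 1))%:R.
  apply: IH => //; first by move=> j' j'js; apply: tch; rewrite inE j'js orbT.
  - exact: ltW.
  - by have /andP[/ltW-> ->] := slotP j.
  - by rewrite nrm1C -clj near_pos.
have vb := v_bound (ltW uj) jr rt.
have sp : (nrm1 (p - pos j)%R)%:R <= e%:R + (v r - v (time c j)) + (d * 2 ^ k)%:R.
  apply: (@le_trans _ _ ((nrm1 (p - g r))%:R + (nrm1 (g r - g (time c j)))%:R +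
      (nrm1 (g (time c j) - pos j))%:R)).
    rewrite -!natrD ler_nat.
    by rewrite (leq_trans (nrm1_triangle _ (g (time c j)) _))// leq_add2r nrm1_triangle.
  by rewrite !lerD// ler_nat// -clj near_pos.
have tm : `|(i%:Z - (slot j)%:Z)%R|%:R <= r - time c j + 1.
  have /andP[s1 s2] := slotP j.
  have : (slot j < i.+1)%N by rewrite -(ltr_nat R) (lt_le_trans s1)// (le_trans jr).
  rewrite ltnS => si; rewrite distnEl// natrB//.
  by move: s2 ir; rewrite -natr1; lra.
rewrite /pdist mulSn.
set K := (d * 2 ^ k)%N in sp IH *; set Z := (size js * _)%N in IH *.
by rewrite mul2n -addnn !natrD; move: sp IH tm => /=; lra.
Qed.

Lemma chain_of_path (k L m : nat) (x : site d) (i0 : nat) (js : seq job) :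
  u <= t -> x = g t -> i0%:R <= t <= i0.+1%:R ->
  t - u + (v t - v u) <= L%:R ->
  uniq js -> (forall j, j \in js -> touched u t g j /\ cl j = k) ->
  (m <= size js)%N ->
  exists js', [/\ uniq js', size js' = m, forall j, j \in js' -> cl j = k &
    (clen (x, i0) [seq (pos j, slot j) | j <- js'] <= L + m * (3 * (d * 2 ^ k)))%N].
Proof.
move=> ut xE ti len ujs tch mjs.
(* The chain starts at the final point of the path, so jobs are sorted by decreasing time and the
   latest [m] are kept. *)
pose le (j j' : job) := time c j' <= time c j.
have tot : total le by move=> a b; exact: le_total.
pose js' := take m (sort le js).
have sub j : j \in js' -> j \in js by move=> /mem_take; rewrite mem_sort.
have sz : size js' = m by rewrite size_takel// size_sort.
exists js'; split=> //.
- by rewrite take_uniq// sort_uniq.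
- by move=> j /sub /tch[].
rewrite -(ler_nat R); apply: le_trans (clen_sorted (k := k) (e := 0) _ _ (lexx t) ut ti _) _.
- by move=> j /sub/tch.
- rewrite (path_sorted_inE (P := predT)); first 1 last.
    by move=> a b d' _ _ _ /[swap]; exact: le_trans.
    by rewrite all_predT.
  apply/andP; split.
    by apply/allP => _ /mapP[j /sub/tch[[/andP[_ jt] _] _] ->].
  by rewrite sorted_map; apply: take_sorted; exact: sort_sorted.
- by rewrite xE nrm1xx.
rewrite addr0 natrD lerD// ler_nat sz leq_mul2l; apply/orP; right.
(* Absorbs the rounding term: [2 * (d * 2 ^ k) + 1] is at most [3 * (d * 2 ^ k)]. *)
have : (0 < d * 2 ^ k)%N by rewrite muln_gt0 d_gt0 expn_gt0.
lia.
Qed.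

End chain_of_path.

(** * Deterministic bound on the workload in the absence of long chains *)

Section workload_bound.
Variables (l : nat -> R) (x : site d) (t : R) (i0 n0 : nat).
Hypothesis l_gt0 : forall k, 0 < l k.
Hypothesis l_sum : forall K, \sum_(k < K) 2 ^+ k / l k <= (8 * d%:R)^-1.
Hypothesis ti0 : i0%:R <= t <= i0.+1%:R.

(** The least integer strictly above [2 ^+ n / l k]: fewer jobs than this means at most
    [2 ^+ n / l k] jobs. *)
Definition critical_size (n k : nat) : nat := (Num.truncn (2 ^+ n / l k)).+1.

(* The second term pays for the distance between a path and the positions of the
   jobs it touches, and for the rounding of times to slots. *)
Definition critical_length (n k : nat) : nat :=
  (2 ^ n + critical_size n k * (3 * (d * 2 ^ k)))%N.

Hypothesis no_chain : forall n k js, (n0 <= n)%N -> uniq js ->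
  size js = critical_size n k -> (forall j, j \in js -> cl j = k) ->
  ~ (clen (x, i0) [seq (pos j, slot j) | j <- js] <= critical_length n k)%N.

(** Stated for finite lists of touched jobs: the service in the score is a supremum over finite
    sets, and nothing so far prevents a path from touching infinitely many jobs. *)
Lemma sum_sizes_le n u g v js : (n0 <= n)%N -> u <= t -> x = g t ->
  (forall r1 r, u <= r1 -> r1 <= r -> r <= t ->
    (nrm1 (g r - g r1))%:R <= v r - v r1) ->
  t - u + (v t - v u) <= 2 ^+ n ->
  uniq js -> (forall j, j \in js -> touched u t g j) ->
  \sum_(j <- js) 2 ^+ cl j <= 2 ^+ n / (8 * d%:R) :> R.
Proof.
move=> n0n ut xE vb len ujs tch.
have count k : (size [seq j <- js | cl j == k])%:R <= 2 ^+ n / l k.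
  have h : (size [seq j <- js | cl j == k] < critical_size n k)%N.
    rewrite ltnNge; apply/negP => big.
    have lenL : t - u + (v t - v u) <= (2 ^ n)%:R by rewrite natrX.
    have tchk j : j \in [seq j <- js | cl j == k] -> touched u t g j /\ cl j = k.
      by rewrite mem_filter => /andP[/eqP-> /tch].
    have [js' [ujs' sz cljs' lejs']] :=
      chain_of_path vb ut xE ti0 lenL (filter_uniq _ ujs) tchk big.
    exact: (no_chain n0n ujs' sz cljs').
  apply: (@le_trans _ _ (Num.truncn (2 ^+ n / l k))%:R); first by rewrite ler_nat -ltnS.
  by rewrite truncn_le// divr_ge0 ?exprn_ge0// ltW.
pose K := (\max_(j <- js) cl j).+1.
have clK j : j \in js -> (cl j < K)%N.
  by move=> j_js; rewrite ltnS (big_rem _ j_js)/= leq_maxl.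
have -> : \sum_(j <- js) 2 ^+ cl j =
    \sum_(k < K) 2 ^+ k * (size [seq j <- js | cl j == k])%:R :> R.
  transitivity (\sum_(j <- js) \sum_(k < K) 2 ^+ k * (cl j == k)%:R : R).
    rewrite [LHS]big_seq [RHS]big_seq; apply: eq_bigr => j /clK jK.
    rewrite (bigD1 (Ordinal jK))//= eqxx mulr1 big1 ?addr0// => k.
    by rewrite -val_eqE/= eq_sym => /negbTE->; rewrite mulr0.
  rewrite exchange_big/=; apply: eq_bigr => k _; rewrite -big_distrr/=; congr (_ * _).
  by rewrite -natr_sum size_filter -sum1_count [in RHS]big_mkcond.
apply: (@le_trans _ _ (\sum_(k < K) 2 ^+ n * (2 ^+ k / l k))).
  apply: ler_sum => k _; rewrite mulrCA ler_wpM2l ?exprn_ge0//.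
by rewrite -big_distrr/= ler_wpM2l ?exprn_ge0// l_sum.
Qed.

Lemma score_le u g : 0 <= u <= t -> admissible_path c u t g -> g t = x ->
  (score c u t g <= (2 ^+ n0)%:E)%E.
Proof.
move=> /andP[u0 ut] [[n [s [s0 sn s_incr g_const]]] jumpP] gt.
pose v := variation g n s.
have vb := variation_bound s0 sn s_incr g_const.
have vu : v u = 0 by exact: (variation_start g s0 s_incr).
have score_sum (b : R) : (forall js, uniq js -> (forall j, j \in js -> touched u t g j) ->
    \sum_(j <- js) 2 ^+ cl j <= b :> R) -> (score c u t g <= (b - (t - u))%:E)%E.
  move=> hb; rewrite /score [leRHS]EFinB; apply: leeD => //.
  apply: ge_ereal_sup => _ [X [finX XS] <-].
  rewrite fsbig_finite//= sumEFin lee_fin.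
  apply: (le_trans _ (hb (fset_set X) _ _)) => //.
    by apply: ler_sum => j _; rewrite -natrX.
    exact: fset_uniq.
  by move=> j; rewrite in_fset_set// => /set_mem /XS.
have v_ge0 : 0 <= v t.
  by rewrite /v /variation sumr_ge0.
set len := t - u + v t.
have [m lenm] : exists m, (n0 <= m)%N /\ len <= 2 ^+ m.
  exists (maxn n0 (Num.truncn len).+1); split; first exact: leq_maxl.
  have /ltW/le_trans := truncnS_gt len; apply.
  rewrite -natrX ler_nat (leq_trans (ltnW (ltn_expl _ (isT : (1 < 2)%N))))//.
  by rewrite leq_exp2l// leq_maxr.
have exm : exists m, (n0 <= m)%N && (len <= 2 ^+ m) by exists m; apply/andP.
(* The dyadic scale of the path, but not below [n0]. At the scale [n0] itself the total service is
   at most [2 ^+ n0 / 8], which suffices. *)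
have [k /andP[n0k lenk] kmin] := ex_minnP exm.
have d0 : 0 < d%:R :> R by rewrite ltr0n.
have d8 : (8 * d%:R)^-1 <= 8^-1 :> R.
  by rewrite lef_pV2 ?posrE ?mulr_gt0// ler_peMr// ler1n.
have sums js : uniq js -> (forall j, j \in js -> touched u t g j) ->
    \sum_(j <- js) 2 ^+ cl j <= 2 ^+ k / (8 * d%:R) :> R.
  by move=> ujs tch; apply: (@sum_sizes_le k u g v) => //; rewrite vu subr0.
apply: (le_trans (score_sum _ sums)); rewrite lee_fin.
have [kn0|n0k'] := leqP k n0.
  have -> : n0 = k by apply/eqP; rewrite eqn_leq n0k.
  have : 2 ^+ k / (8 * d%:R) <= 2 ^+ k * 8^-1 :> R by rewrite ler_wpM2l ?exprn_ge0.
  have : 0 <= 2 ^+ k :> R by rewrite exprn_ge0.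
  by move: ut; lra.
(* Above [n0], minimality gives a length over [2 ^+ k / 2]. Jumps take at most [2 ^+ k / 8] of it,
   so the duration exceeds [3 / 8 * 2 ^+ k], while the service is at most [2 ^+ k / 8]. *)
have k_half : 2 ^+ k < 2 * len.
  case: (k) n0k' kmin => // k' n0k' kmin.
  rewrite exprS ltr_pM2l// ltNge; apply/negP => h.
  by have := kmin k'; rewrite ltnn -ltnS n0k' h => /(_ isT).
have [js [ujs tch vle]] := variation_jobs s0 sn s_incr g_const jumpP.
have vt : v t <= 2 ^+ k * 8^-1.
  apply: (le_trans vle).
  have -> : \sum_(j <- js) (d * 2 ^ cl j)%:R = d%:R * \sum_(j <- js) 2 ^+ cl j :> R.
    by rewrite big_distrr/=; apply: eq_bigr => j _; rewrite natrM natrX.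
  apply: (@le_trans _ _ (d%:R * (2 ^+ k / (8 * d%:R)))).
    by rewrite ler_wpM2l// sums.
  by rewrite invfM mulrCA mulrA mulrACA [d%:R * _]mulrC -mulrA mulVf ?gt_eqF// mulr1.
have : 2 ^+ k / (8 * d%:R) <= 2 ^+ k * 8^-1 :> R by rewrite ler_wpM2l ?exprn_ge0.
have : 0 <= 2 ^+ n0 :> R by rewrite exprn_ge0.
by move: k_half vt; rewrite /len; lra.
Qed.

Lemma workload_of_le : (workload_of c t x <= (2 ^+ n0)%:E)%E.
Proof.
apply: ge_ereal_sup => _ [u [g [ut adm gt ->]]]; exact: score_le.
Qed.

End workload_bound.

End path_bound.

(** * Measurability of the workload *)

Section skeleton.
Context {R : realType} {d : nat}.
Variable c : configuration R d.
Local Notation job := (site d * nat)%type.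
Implicit Types (x y : site d) (js : seq (job * site d)) (u t r : R).

(* A path is encoded by its starting point x0 and, latest jump first, by the jobs
   used at its jumps with the sites then reached. *)
Fixpoint walk x0 js r : site d :=
  if js is (j, y) :: js' then (if time c j <= r then y else walk x0 js' r) else x0.

Definition walk_end x0 js : site d := if js is (_, y) :: _ then y else x0.

Definition latest u js : R := if js is (j, _) :: _ then time c j else u.

Fixpoint walk_valid u x0 js : Prop :=
  if js is (j, y) :: js' then
    [/\ latest u js' < time c j, y \in servers c j,
        walk_end x0 js' \in servers c j & walk_valid u x0 js']
  else True.

Lemma walk_after u x0 js r : latest u js <= r -> walk x0 js r = walk_end x0 js.
Proof. by case: js => [//|[j y] js] /= ->. Qed.

Lemma pcc_change u t (g g' : R -> site d) :
  (forall r, u <= r < t -> g r = g' r) ->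
  piecewise_constant_cadlag u t g -> piecewise_constant_cadlag u t g'.
Proof.
move=> gg' [n [s [s0 sn s_incr g_const]]]; exists n, s; split=> // i r i_n ir.
have mono a b : (a <= b)%N -> (b <= n)%N -> s a <= s b.
  exact: (step_times_mono s_incr).
have /andP[ir1 ir2] := ir.
have in_range r' : s i <= r' < s i.+1 -> u <= r' < t.
  move=> /andP[h1 h2]; rewrite -s0 -sn (le_trans (mono 0%N i _ _) h1)//=; last exact: ltnW.
  exact: lt_le_trans h2 (mono i.+1 n _ _).
rewrite -!gg' ?in_range//; first exact: g_const.
by rewrite lexx s_incr.
Qed.

Lemma pcc_extend u a t (g : R -> site d) : a < t ->
  (forall r, a <= r < t -> g r = g a) ->
  piecewise_constant_cadlag u a g -> piecewise_constant_cadlag u t g.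
Proof.
move=> a_t ga [n [s [s0 sn s_incr g_const]]].
exists n.+1, (fun i => if (i <= n)%N then s i else t); split=> //.
- by rewrite ltnn.
- move=> i; rewrite ltnS => i_n; rewrite i_n; case: ltnP => [lt|le]; first exact: s_incr.
  by have -> : i = n by [apply/eqP; rewrite eqn_leq i_n]; rewrite sn.
- move=> i r; rewrite ltnS => i_n; rewrite i_n; case: ltnP => [lt|le]; first exact: g_const.
  by have -> : i = n by [apply/eqP; rewrite eqn_leq i_n]; rewrite sn => /ga.
Qed.

Lemma walk_pcc u t x0 js : walk_valid u x0 js -> latest u js <= t ->
  piecewise_constant_cadlag u t (walk x0 js).
Proof.
have trivial_pcc (g : R -> site d) : piecewise_constant_cadlag u u g.
  by exists 0%N, (fun=> u); split.
elim: js t => [|[j y] js IH] t /=.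
  move=> _; rewrite le_eqVlt => /orP[/eqP<-//|ut].
  exact: (pcc_extend ut).
move=> [lt _ _ valid].
have pj : piecewise_constant_cadlag u (time c j) (walk x0 ((j, y) :: js)).
  apply: pcc_change (IH (time c j) valid (ltW lt)) => r /andP[_ rj] /=.
  by rewrite leNgt rj.
rewrite le_eqVlt => /orP[/eqP<-//|jt]; apply: (pcc_extend jt) => //.
by move=> r /andP[jr _]; rewrite /= jr lexx.
Qed.

Lemma left_limit_unique (g : R -> site d) (r : R) (y z : site d) :
  (\forall r' \near r^'-, g r' = y) -> (\forall r' \near r^'-, g r' = z) -> y = z.
Proof.
move=> gy gz.
have gyz : \forall r' \near r^'-, g r' = y /\ g r' = z by apply: filterS2 gy gz.
by have [r' [<- <-]] := @filter_ex _ _ (at_left_proper_filter r) _ gyz.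
Qed.

Lemma walk_jump u x0 js (r : R) (y : site d) : walk_valid u x0 js -> u < r ->
  (\forall r' \near r^'-, walk x0 js r' = y) -> walk x0 js r <> y ->
  exists j : job, [/\ time c j = r, walk x0 js r \in servers c j & y \in servers c j].
Proof.
elim: js => [|[j z] js IH] /=.
  by move=> _ _ /(left_limit_unique (y := x0)) <-//; exact: nearW.
move=> [lt zj ej valid] ur near_y.
have [rj|jr|rj] := ltgtP r (time c j).
- apply: IH => //; near=> r'.
  have <- : (if time c j <= r' then z else walk x0 js r') = y by near: r'.
  rewrite ifF//; apply/negbTE; rewrite -ltNge; apply: lt_trans rj.
  by near: r'; exact: nbhs_left_lt.
- case; apply: left_limit_unique near_y; near=> r'.
  by rewrite ifT//; near: r'; exact: nbhs_left_ge.
- move=> zy; exists j; split=> //.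
  rewrite (_ : y = walk_end x0 js)//; apply: left_limit_unique near_y _.
  near=> r'; rewrite ifF.
    by apply: (@walk_after u); near: r'; apply: nbhs_left_ge; rewrite rj.
  by apply/negbTE; rewrite -ltNge -rj; near: r'; exact: nbhs_left_lt.
Unshelve. all: by end_near.
Qed.

Lemma walk_admissible u t x0 js : walk_valid u x0 js -> latest u js <= t ->
  admissible_path c u t (walk x0 js).
Proof.
move=> valid le; split; first exact: walk_pcc.
by move=> r y /andP[ur _]; exact: (walk_jump valid ur).
Qed.

(** The converse of [walk_admissible], by induction on the pieces: a step time at which the path
    does not move adds nothing to the code, and at a true jump admissibility supplies the job. *)
Lemma path_is_walk u t g : admissible_path c u t g -> exists x0 js,
  [/\ walk_valid u x0 js, latest u js <= t & forall r, u <= r <= t -> walk x0 js r = g r].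
Proof.
move=> [[n [s [s0 sn s_incr g_const]]] jumpP].
have mono := step_times_mono s_incr.
suff /(_ n (leqnn n)) : forall i, (i <= n)%N -> exists x0 js,
    [/\ walk_valid u x0 js, latest u js <= s i &
        forall r, u <= r <= s i -> walk x0 js r = g r] by rewrite sn.
elim=> [_|i IH i_n].
  exists (g u), [::]; split=> //; first by rewrite s0.
  by move=> r; rewrite s0 => /le_anti<-.
have [x0 [js [valid le agree]]] := IH (ltnW i_n).
have agree_before r : u <= r < s i.+1 -> walk x0 js r = g r.
  move=> /andP[ur ri]; have [rsi|sir] := leP r (s i); first by rewrite agree ?ur.
  rewrite (g_const i)//; last by rewrite ri ltW.
  rewrite -agree ?lexx ?andbT; last by rewrite -s0 mono// ltnW.
  by rewrite !(@walk_after u)// (le_trans le)// ltW.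
have [gE|/eqP gN] := eqVneq (g (s i.+1)) (g (s i)).
  exists x0, js; split=> //; first by rewrite (le_trans le)// ltW// s_incr.
  move=> r /andP[ur]; rewrite le_eqVlt => /orP[/eqP->|ri]; last first.
    by apply: agree_before; rewrite ur.
  rewrite gE -agree ?lexx ?andbT; last by rewrite -s0 mono// ltnW.
  by rewrite !(@walk_after u)// (le_trans le)// ltW// s_incr.
have [j [tj gj gj']] := jump_job s0 sn s_incr g_const jumpP i_n gN.
have endE : walk_end x0 js = g (s i).
  rewrite -agree ?lexx ?andbT; last by rewrite -s0 mono// ltnW.
  by rewrite (@walk_after u).
exists x0, ((j, g (s i.+1)) :: js); split=> /=.
- by rewrite tj endE; split=> //; exact: le_lt_trans le (s_incr _ i_n).
- by rewrite tj.
- move=> r /andP[ur]; rewrite tj le_eqVlt => /orP[/eqP->|ri]; first by rewrite lexx.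
  by rewrite leNgt ri/= agree_before// ur.
Qed.

Lemma walk_valid_start u x0 js t : u < t -> walk_valid u x0 js -> latest u js <= t ->
  exists2 u1, u < u1 & forall u', u <= u' <= u1 -> walk_valid u' x0 js /\ latest u' js <= t.
Proof.
move=> ut valid le.
suff [u1 uu1 h] : exists2 u1, u < u1 &
    forall u', u <= u' <= u1 -> walk_valid u' x0 js.
  exists (Num.min u1 t); first by rewrite lt_min uu1 ut.
  move=> u' /andP[h1]; rewrite le_min => /andP[h2 h3]; split; first by apply: h; rewrite h1.
  by move: le; case: (js) => [|[]].
elim: js valid {le} => [_|[j y] js IH] /=; first by exists t.
move=> [lt yj ej /IH [u1 uu1 h]].
have [ltm h'] : exists2 u2, u < u2 & forall u', u' <= u2 -> latest u' js < time c j.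
  move: lt; case: (js) => [|[j' y'] js'] /= lt; last by exists t.
  exists ((u + time c j) / 2); first lra.
  by move=> u' h'; apply: (le_lt_trans h'); lra.
move=> h2; exists (Num.min u1 ltm); first by rewrite lt_min uu1.
move=> u' /andP[hu']; rewrite le_min => /andP[a b]; split=> //; first exact: h2.
by apply: h; rewrite hu'.
Qed.

Lemma exists_before u (s : seq job) : (forall j, j \in s -> u < time c j) ->
  exists2 u', u < u' & forall j, j \in s -> u' < time c j.
Proof.
elim: s => [_|j s IH h]; first by exists (u + 1) => //; rewrite ltrDl.
have [|u' h1 h2] := IH; first by move=> j' j's; apply: h; rewrite inE j's orbT.
have uj := h j (mem_head _ _).
exists (Num.min u' ((u + time c j) / 2)); first by rewrite lt_min h1/=; lra.
move=> j'; rewrite inE gt_min => /orP[/eqP->|/h2->//].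
by apply/orP; right; lra.
Qed.

Lemma workload_ge0 t x : 0 <= t -> (0 <= workload_of c t x)%E.
Proof.
move=> t0; apply: ereal_sup_ubound; exists t, (fun=> x); split=> //.
- by rewrite t0 lexx.
- split; first by exists 0%N, (fun=> t).
  by move=> s y /andP[h1 h2]; have := lt_le_trans h1 h2; rewrite ltxx.
- rewrite /score subrr sube0; apply/esym/esum1 => j [/andP[h1 h2] _].
  by have := lt_le_trans h1 h2; rewrite ltxx.
Qed.

Definition walk_gain u t x0 js (F : seq job) (b : R) : Prop :=
  [/\ walk_valid u x0 js, latest u js <= t,
      forall j, j \in F -> u < time c j <= t /\ walk x0 js (time c j) \in servers c j &
      b + (t - u) < \sum_(j <- F) service c j].

(* A finite set F of jobs suffices because esum is a supremum over finite sets
   (it ignores negative services), and a rational starting time because moving it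
   slightly forward loses no job of F. *)
Lemma workload_gtP t x (b : R) : 0 <= t -> (b%:E < workload_of c t x)%E <->
  b < 0 \/ exists (u : rat) x0 js (F : {fset job}),
    [/\ 0 <= ratr u :> R, ratr u < t, walk_end x0 js = x & walk_gain (ratr u) t x0 js F b].
Proof.
move=> t0; split.
- move=> /ereal_sup_gt [_ [u [g [/andP[u0 ut'] adm gt ->]]]].
  (* A rational start strictly before [t] requires [u < t]. The degenerate path has score 0 and
     accounts for the alternative [b < 0]. *)
  move: ut'; rewrite le_eqVlt => /orP[/eqP uE|ut].
    rewrite /score uE subrr sube0 esum1; first by rewrite lte_fin; left.
    by move=> j [/andP[h1 h2] _]; have := lt_le_trans h1 h2; rewrite ltxx.
  rewrite /score lteBrDr// => /ereal_sup_gt [_ [X [finX XS] <-]].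
  rewrite fsbig_finite//= sumEFin -EFinD lte_fin => gain; right.
  have [x0 [js [valid le agree]]] := path_is_walk adm.
  have [u1 uu1 hu1] := walk_valid_start ut valid le.
  have [u2 uu2 hu2] : exists2 u2, u < u2 & forall j, j \in fset_set X -> u2 < time c j.
    apply: (@exists_before u (enum_fset (fset_set X))) => j.
    by rewrite in_fset_set// => /set_mem /XS [/andP[]].
  have : u < Num.min t (Num.min u1 u2) by rewrite !lt_min ut uu1.
  move=> /rat_in_itvoo [u']; rewrite in_itv/= !lt_min => /andP[uu' /and3P[u't u'1 u'2]].
  have [valid' le'] : walk_valid (ratr u') x0 js /\ latest (ratr u') js <= t.
    by apply: hu1; rewrite !ltW.
  exists u', x0, js, (fset_set X); split=> //; first by rewrite (le_trans u0)// ltW.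
    by rewrite -(@walk_after u _ _ t)// agree ?gt// lexx ltW.
  split=> // [j jX|].
    have /XS [/andP[uj jt] gj] : X j by move: jX; rewrite in_fset_set// => /set_mem.
    by rewrite jt (lt_trans u'2 (hu2 _ jX)) agree// (ltW uj).
  by apply: le_lt_trans gain; rewrite lerD2l lerD2l lerN2 ltW.
- case=> [b0|]; first by apply: lt_le_trans (workload_ge0 x t0); rewrite lte_fin.
  move=> [u [x0 [js [F [u0 ut xE [valid le Fin gain]]]]]].
  apply: (@lt_le_trans _ _ (score c (ratr u) t (walk x0 js))); last first.
    apply: ereal_sup_ubound; exists (ratr u), (walk x0 js); split=> //.
    - by rewrite u0 ltW.
    - exact: walk_admissible.
    - by rewrite (@walk_after (ratr u)).
  rewrite /score lteBrDr//; apply: (@lt_le_trans _ _ (\sum_(j <- F) service c j)%:E).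
    by rewrite -EFinD lte_fin.
  apply: ereal_sup_ubound; exists [set` F].
    by split; [exact: finite_fset | move=> j /Fin].
  by rewrite -sumEFin fsbig_finite ?set_fsetK.
Qed.

End skeleton.

Section measurable_workload.
Context {d : nat} {R : realType} {disp : measure_display}.
Context {Omega : measurableType disp} {P : probability Omega R} {lambda : R}.
Context {law : set (R * siteset d) -> \bar R}.
Variable H : poisson_hail P lambda law.
Local Notation job := (site d * nat)%type.
Local Notation conf := (hail_configuration H).

Lemma measurable_lt_set (f g : Omega -> R) : measurable_fun setT f ->
  measurable_fun setT g -> measurable [set om | f om < g om].
Proof.
move=> mf mg; rewrite -[X in measurable X]setTI.
exact: (measurable_fun_ltr mf mg measurableT (Y := [set true])).
Qed.

Lemma measurable_le_set (f g : Omega -> R) : measurable_fun setT f ->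
  measurable_fun setT g -> measurable [set om | f om <= g om].
Proof.
move=> mf mg; rewrite -[X in measurable X]setTI.
exact: (measurable_fun_ler mf mg measurableT (Y := [set true])).
Qed.

Lemma measurable_time (j : job) : measurable_fun setT (fun om => time (conf om) j).
Proof. by have [mT _ _ _] := arrivalP H j.1; exact: mT. Qed.

Lemma measurable_service (j : job) : measurable_fun setT (fun om => service (conf om) j).
Proof. exact: (measurableT_comp measurable_fst (measurable_mark H j.1 j.2)). Qed.

Lemma measurable_in_servers (j : job) y : measurable [set om | y \in servers (conf om) j].
Proof.
have -> : [set om | y \in servers (conf om) j] = mark H j.1 j.2 @^-1`
    (setT `*` [set B : siteset d | y \in translate B j.1]).
  by apply/seteqP; split=> om //= [].
by apply: measurable_mark_event; exact: measurableX.
Qed.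

Lemma measurable_latest (u : R) js : measurable_fun setT (fun om => latest (conf om) u js).
Proof.
by case: js => [|[j y] js] /=; [exact: measurable_cst|exact: measurable_time].
Qed.

Lemma measurable_walk_valid (u : R) x0 js : measurable [set om | walk_valid (conf om) u x0 js].
Proof.
elim: js => [|[j y] js IH] /=; first exact: measurableT.
have -> : [set om | [/\ latest (conf om) u js < time (conf om) j, y \in servers (conf om) j,
    walk_end x0 js \in servers (conf om) j & walk_valid (conf om) u x0 js]] =
  [set om | latest (conf om) u js < time (conf om) j] `&`
  [set om | y \in servers (conf om) j] `&`
  [set om | walk_end x0 js \in servers (conf om) j] `&`
  [set om | walk_valid (conf om) u x0 js].
  by apply/seteqP; split=> om /= [] => [? ? ? ?|[[? ?] ?] ?].
do !apply: measurableI => //; try exact: measurable_in_servers.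
by apply: measurable_lt_set; [exact: measurable_latest|exact: measurable_time].
Qed.

Lemma measurable_walk_in x0 js (j : job) :
  measurable [set om | walk (conf om) x0 js (time (conf om) j) \in servers (conf om) j].
Proof.
elim: js => [|[j' y] js IH] /=; first exact: measurable_in_servers.
have -> : [set om | (if time (conf om) j' <= time (conf om) j then y
      else walk (conf om) x0 js (time (conf om) j)) \in servers (conf om) j] =
  [set om | time (conf om) j' <= time (conf om) j] `&` [set om | y \in servers (conf om) j] `|`
  [set om | time (conf om) j < time (conf om) j'] `&`
    [set om | walk (conf om) x0 js (time (conf om) j) \in servers (conf om) j].
  apply/seteqP; split=> om /=.
    by case: leP => ? ?; [left|right].
  by case=> -[h]; [rewrite h | rewrite leNgt h].
apply: measurableU; apply: measurableI => //; try exact: measurable_in_servers.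
  by apply: measurable_le_set; exact: measurable_time.
by apply: measurable_lt_set; exact: measurable_time.
Qed.

Lemma measurable_walk_gain (u t : R) x0 js (F : {fset job}) b :
  measurable [set om | walk_gain (conf om) u t x0 js F b].
Proof.
have -> : [set om | walk_gain (conf om) u t x0 js F b] =
  [set om | walk_valid (conf om) u x0 js] `&` [set om | latest (conf om) u js <= t] `&`
  (\bigcap_(j in [set` F]) ([set om | u < time (conf om) j] `&`
     [set om | time (conf om) j <= t] `&`
     [set om | walk (conf om) x0 js (time (conf om) j) \in servers (conf om) j])) `&`
  [set om | b + (t - u) < \sum_(j <- F) service (conf om) j].
  apply/seteqP; split=> om /=.
    by move=> [h1 h2 h3 h4]; split=> //; split=> // j /h3 [/andP[]].
  move=> [[[h1 h2] h3] h4]; split=> // j jF; have [[-> ->] ?] := h3 j jF.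
  by split.
apply: measurableI; [apply: measurableI; [apply: measurableI|]|].
- exact: measurable_walk_valid.
- by apply: measurable_le_set; [exact: measurable_latest|exact: measurable_cst].
- apply: fin_bigcap_measurable => // j _; apply: measurableI; last exact: measurable_walk_in.
  apply: measurableI.
    by apply: measurable_lt_set; [exact: measurable_cst|exact: measurable_time].
  by apply: measurable_le_set; [exact: measurable_time|exact: measurable_cst].
- apply: measurable_lt_set; first exact: measurable_cst.
  by apply: measurable_sum => j; exact: measurable_service.
Qed.

(** There are uncountably many paths, but [b < W] is a union over countably many codes: a rational
    start, a starting site, a list of jumps and a finite set of jobs. *)
Lemma measurable_workload (t : R) (x : site d) :
  0 <= t -> measurable_fun setT (workload H t x).
Proof.
move=> t0; apply: (measurability _ (ErealGenOInfty.measurableE R)) => // _ [_ [b ->] <-].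
rewrite setTI preimage_itvoy.
have -> : [set om | (b%:E < workload H t x om)%E] = [set om | b < 0] `|`
    \bigcup_(p in [set p : rat * site d * seq (job * site d) * {fset job} |
        [/\ 0 <= ratr p.1.1.1 :> R, ratr p.1.1.1 < t & walk_end p.1.1.2 p.1.2 = x]])
      [set om | walk_gain (conf om) (ratr p.1.1.1) t p.1.1.2 p.1.2 p.2 b].
  apply/seteqP; split=> om.
    move=> /(workload_gtP (conf om) x b t0) [b0|]; first by left.
    by move=> [u [x0 [js [F [h1 h2 h3 h4]]]]]; right; exists (u, x0, js, F).
  move=> h; apply/(workload_gtP (conf om) x b t0); case: h => [b0|]; first by left.
  by move=> [[[[u x0] js] F] /= [h1 h2 h3] h4]; right; exists u, x0, js, F.
apply: measurableU.
  by apply: measurable_lt_set; exact: measurable_cst.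
by apply: countable_bigcup_measurable => p _; exact: measurable_walk_gain.
Qed.

End measurable_workload.

(** * Size classes *)

Section size_class.
Context {R : realType} {d : nat}.
Implicit Types (B : {fset site d}) (k : nat).

(* The position of a job at w with mark B is w + anchor B rather than w, since B
   itself may be far away from the origin. *)
Definition anchor B : site d := head 0 (enum_fset B).

Lemma anchor_in B y : y \in B -> anchor B \in B.
Proof.
have : y \in enum_fset B -> head 0 (enum_fset B) \in enum_fset B; last exact.
by case: (enum_fset B) => // z s _; rewrite mem_head.
Qed.

Lemma nrm1_le_diam B y z : y \in B -> z \in B -> (nrm1 (y - z) <= d * diam B)%N.
Proof.
move=> yB zB; apply: (@leq_trans (\sum_(i < d) diam B)); last first.
  by rewrite sum_nat_const card_ord.
apply: leq_sum => i _; apply: (@leq_trans (supnorm (y - z))).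
  exact: (leq_bigmax i).
apply: leq_trans (leq_bigmax_seq _ yB isT).
by rewrite (big_rem _ zB)/= leq_maxl.
Qed.

Definition small_mark k : set (R * siteset d) :=
  [set m | m.1 <= 2 ^+ k /\ (diam m.2 <= 2 ^ k)%N].

Definition size_class : nat -> set (R * siteset d) := seqD small_mark.

(** A job arriving at [l.2] has its mark translated by [l.2], so its server set is positioned at
    [l.1.1] when the anchor of the mark is [l.1.1 - l.2]. *)
Definition located_class k (l : label d) : set (R * siteset d) :=
  size_class k `&` [set m | anchor m.2 = l.1.1 - l.2].

Lemma size_class_small k : size_class k `<=` small_mark k.
Proof. by case: k => // k m []. Qed.

Lemma exists_size_class m : exists k, size_class k m.
Proof.
have [k _ h] : (\bigcup_k size_class k) m; last by exists k.
rewrite eq_bigcup_seqD.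
pose N := maxn (diam m.2) (Num.truncn m.1).+1.
have NN : (N <= 2 ^ N)%N by rewrite ltnW// ltn_expl.
exists N => //; split; last by rewrite (leq_trans _ NN)// leq_maxl.
apply: (le_trans (ltW (truncnS_gt _))).
by rewrite -natrX ler_nat (leq_trans _ NN)// leq_maxr.
Qed.

Lemma measurable_small_mark k : measurable (small_mark k).
Proof.
have -> : small_mark k = `]-oo, 2 ^+ k]%classic `*` [set B : siteset d | (diam B <= 2 ^ k)%N].
  by apply/seteqP; split=> m [] /= h1 h2; split=> //=; move: h1; rewrite in_itv.
by apply: measurableX => //; exact: measurable_itv.
Qed.

Lemma measurable_size_class k : measurable (size_class k).
Proof.
case: k => [|k]; first exact: measurable_small_mark.
by apply: measurableD; exact: measurable_small_mark.
Qed.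

Lemma measurable_located_class k l : measurable (located_class k l).
Proof.
apply: measurableI; first exact: measurable_size_class.
have -> : [set m : R * siteset d | anchor m.2 = l.1.1 - l.2] =
    setT `*` [set B : siteset d | anchor B = l.1.1 - l.2].
  by apply/seteqP; split=> m /=; [split|case].
exact: measurableX.
Qed.

End size_class.

Section off_bad.
Context {d : nat} {R : realType} {disp : measure_display}.
Context {Omega : measurableType disp} {P : probability Omega R} {lambda : R}.
Context {law : set (R * siteset d) -> \bar R}.
Variable H : poisson_hail P lambda law.
Variables (l : nat -> R) (x : site d).
Hypothesis d_gt0 : (0 < d)%N.
Hypothesis l_gt0 : forall k, 0 < l k.
Hypothesis l_sum : forall K, \sum_(k < K) 2 ^+ k / l k <= (8 * d%:R)^-1.

Definition bad_event (i0 n k : nat) : set Omega :=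
  \bigcup_(ls in [set ls | size ls = critical_size l n k /\
      (clen (x, i0) [seq l.1 | l <- ls] <= critical_length (d := d) l n k)%N])
    chain_event H (located_class k) ls.

(** For a fixed outcome, a class, a slot and a position are attached to every job and the
    deterministic bound applies: a forbidden list of jobs, turned into labels, would witness a bad
    event. *)
Lemma workload_off_bad (t : R) (i0 n0 : nat) (om : Omega) :
  i0%:R <= t <= i0.+1%:R ->
  (forall n k, (n0 <= n)%N -> ~ bad_event i0 n k om) ->
  (workload H t x om <= (2 ^+ n0)%:E)%E.
Proof.
move=> ti0 good.
have [cl clP] := choice (fun j : site d * nat => exists_size_class (mark H j.1 j.2 om)).
have ex_slot (j : site d * nat) : exists i : nat, i%:R < arrival H j.1 j.2 om <= i.+1%:R.
  have [_ T0 T_incr _] := arrivalP H j.1.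
  have [Tpos _] := increasing_pos_mono (T0 om) (fun n => T_incr n om).
  have ex : exists i : nat, arrival H j.1 j.2 om <= i.+1%:R.
    by exists (Num.truncn (arrival H j.1 j.2 om)); exact/ltW/truncnS_gt.
  have [i hi imin] := ex_minnP ex.
  exists i; rewrite hi andbT; case: i hi imin => [|i] hi imin.
    exact: Tpos.
  by rewrite ltNge; apply/negP => /imin; rewrite ltnn.
have [slot slotP] := choice ex_slot.
pose pos (j : site d * nat) := j.1 + anchor (mark H j.1 j.2 om).2.
have serversE j y : y \in translate (mark H j.1 j.2 om).2 j.1 ->
    exists2 z, z \in (mark H j.1 j.2 om).2 & y = z + j.1.
  by move=> /imfsetP[z zB ->]; exists z.
have diam_le j : (d * diam (mark H j.1 j.2 om).2 <= d * 2 ^ cl j)%N.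
  by rewrite leq_mul2l; have [_ ->] := size_class_small (clP j); rewrite orbT.
apply: (@workload_of_le R d (hail_configuration H om) pos cl slot) ti0 _ => //.
- move=> j y /serversE[z zB ->]; apply: leq_trans (diam_le j).
  rewrite /pos addrKA.
  exact: nrm1_le_diam (anchor_in zB).
- move=> j y y' /serversE[z zB ->] /serversE[z' z'B ->]; apply: leq_trans (diam_le j).
  by rewrite [z' + _]addrC addrKA; exact: nrm1_le_diam.
- by move=> j /=; rewrite natrX; have [] := size_class_small (clP j).
- move=> n k js n0n ujs sz clk len.
  apply: (good n k n0n).
  exists [seq ((pos j, slot j), j.1) | j <- js].
    by split; [rewrite size_map | rewrite -map_comp].
  exists [seq j.2 | j <- js]; split.
  - by rewrite !size_map.
  - rewrite -map_comp zip_map/=.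
    by rewrite (@eq_map _ _ _ id) ?map_id//; case.
  - move=> l' n'; rewrite zip_map => /mapP[j jjs [-> ->]] /=.
    split; first exact: slotP.
    split; first by rewrite -(clk j jjs); exact: clP.
    by rewrite /= /pos addrC addKr.
Qed.

End off_bad.

(** * Class probabilities under the job law *)

Section job_law.
Context {R : realType} {d : nat} {disp0 : measure_display}.
Context {Omega0 : measurableType disp0} {P0 : probability Omega0 R}.
Variables (tau : {RV P0 >-> R}) (B : {RV P0 >-> siteset d}).

Local Notation law := (pushforward P0 (fun om => (tau om, B om))).

Lemma measurable_job : measurable_fun setT (fun om => (tau om, B om)).
Proof. by apply: measurable_fun_pair; exact: measurable_funPT. Qed.

Lemma measurable_job_preimage (A : set (R * siteset d)) :
  measurable A -> measurable ((fun om => (tau om, B om)) @^-1` A).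
Proof. by move=> mA; rewrite -[X in measurable X]setTI; exact: measurable_job. Qed.

Lemma law_fin (A : set (R * siteset d)) : measurable A -> law A = (fine (law A))%:E.
Proof.
by move=> mA; rewrite fineK// /pushforward fin_num_measure//; exact: measurable_job_preimage.
Qed.

(** For a fixed position the anchors [p.1 - w] differ from site to site, so the events are disjoint.
    However far [B] lies from the origin, the jobs positioned at one point have at most the total
    mass of those arriving at one site. *)
Lemma sum_located_class k (p : site d * nat) (s : seq (site d)) : uniq s ->
  \sum_(w <- s) fine (law (located_class k (p, w))) <= fine (law (size_class k)).
Proof.
move=> us; rewrite -lee_fin -sumEFin -law_fin; last exact: measurable_size_class.
rewrite (eq_bigr (fun w => law (located_class k (p, w)))); last first.
  by move=> w _; rewrite -law_fin//; exact: measurable_located_class.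
pose F w := (fun om => (tau om, B om)) @^-1` located_class k (p, w).
have mF w : measurable (F w).
  by apply: measurable_job_preimage; exact: measurable_located_class.
have -> : (\sum_(w <- s) law (located_class k (p, w)) =
    P0 (\bigcup_(w in [set` s]) F w))%E.
  rewrite measure_fin_bigcup -?fsbig_seq//; first exact: finite_seq.
  move=> w w' _ _ [om [[_ h] [_ h']]].
  by move: h; rewrite /= h' => /addrI/oppr_inj.
apply: le_measure; rewrite ?inE.
- exact: fin_bigcup_measurable.
- by apply: measurable_job_preimage; exact: measurable_size_class.
- by move=> om [w _ []].
Qed.

Lemma markov_le (f : Omega0 -> R) (A : set Omega0) (a : R) :
  measurable_fun setT f -> (forall om, 0 <= f om) -> measurable A -> 0 <= a ->
  A `<=` [set om | a <= f om] -> (a%:E * P0 A <= 'E_P0[f])%E.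
Proof.
move=> mf f0 mA a0 Af; rewrite unlock.
have mEf : measurable_fun setT (EFin \o f) by exact/measurable_EFinP.
rewrite -integral_cst//.
apply: (@le_trans _ _ (\int[P0]_(om in A) (f om)%:E)%E).
  apply: ge0_le_integral => //.
  by apply: measurable_funS mEf.
by apply: ge0_subset_integral => // om _; rewrite lee_fin.
Qed.

Lemma size_class_decay (alpha : R) : 0 <= alpha ->
  ('E_P0[fun om => (tau om `^ alpha)%R] +
   'E_P0[fun om => ((diam (B om))%:R `^ alpha)%R] < +oo)%E ->
  exists2 C : R, 0 < C &
    forall k, fine (law (size_class k)) <= C * (2 `^ alpha) ^- k.
Proof.
move=> al0 fin.
set f1 := fun om => tau om `^ alpha in fin; set f2 := fun om => _ `^ alpha in fin.
have f10 om : 0 <= f1 om by exact: powR_ge0.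
have f20 om : 0 <= f2 om by exact: powR_ge0.
have mf1 : measurable_fun setT f1.
  by apply: (measurableT_comp (measurable_powR alpha)); exact: measurable_funPT.
have mf2 : measurable_fun setT f2.
  apply: (@measurableT_comp _ _ _ _ _ _ (fun b : siteset d => (diam b)%:R `^ alpha)) => //.
have E10 : (0 <= 'E_P0[f1])%E.
  by rewrite unlock; apply: integral_ge0 => om _; rewrite lee_fin.
have E20 : (0 <= 'E_P0[f2])%E.
  by rewrite unlock; apply: integral_ge0 => om _; rewrite lee_fin.
have E1fin : ('E_P0[f1])%E \is a fin_num.
  by rewrite ge0_fin_numE// (le_lt_trans _ fin)// leeDl.
have E2fin : ('E_P0[f2])%E \is a fin_num.
  by rewrite ge0_fin_numE// (le_lt_trans _ fin)// leeDr.
pose M := fine ('E_P0[f1])%E + fine ('E_P0[f2])%E.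
have M0 : 0 <= M by rewrite addr_ge0// fine_ge0.
have b0 : 0 < 2 `^ alpha by rewrite powR_gt0.
exists (1 + 2 `^ alpha * M); first by rewrite ltr_pwDl// mulr_ge0// ltW.
have m_class k : measurable ((fun om => (tau om, B om)) @^-1` size_class k).
  by apply: measurable_job_preimage; exact: measurable_size_class.
case=> [|k].
  rewrite expr0 invr1 mulr1; apply: (@le_trans _ _ 1); last by rewrite lerDl mulr_ge0// ltW.
  by rewrite -lee_fin -law_fin ?probability_le1//; exact: measurable_size_class.
rewrite ler_pdivlMr ?exprn_gt0//.
apply: (@le_trans _ _ (2 `^ alpha * M)); last by rewrite lerDr.
rewrite exprS mulrCA ler_pM2l//.
pose A1 := [set om | 2 ^+ k < tau om]; pose A2 := [set om | (2 ^ k < diam (B om))%N].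
have mA1 : measurable A1.
  have -> : A1 = setT `&` tau @^-1` `]2 ^+ k, +oo[%classic.
    by rewrite setTI; apply/seteqP; split=> om /=; rewrite in_itv/= andbT.
  by apply: (measurable_funPT tau) => //; exact: measurable_itv.
have mA2 : measurable A2.
  have -> : A2 = setT `&` B @^-1` [set b | (2 ^ k < diam b)%N] by rewrite setTI.
  by apply: (measurable_funPT B).
have powE : (2 ^+ k) `^ alpha = (2 `^ alpha) ^+ k :> R.
  by rewrite -(powR_mulrn k (ler0n R 2)) -(powR_mulrn k (powR_ge0 2 alpha)) powRAC.
have h1 : (((2 `^ alpha) ^+ k)%:E * P0 A1 <= 'E_P0[f1])%E.
  apply: markov_le => //.
  move=> om /ltW h /=; rewrite -powE ge0_ler_powR// nnegrE ?exprn_ge0//.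
  by apply: le_trans h; rewrite exprn_ge0.
have h2 : (((2 `^ alpha) ^+ k)%:E * P0 A2 <= 'E_P0[f2])%E.
  apply: markov_le => //.
  move=> om /ltnW h /=; rewrite -powE ge0_ler_powR// ?nnegrE ?exprn_ge0//.
  by rewrite -natrX ler_nat.
rewrite -lee_fin EFinM -law_fin; last exact: measurable_size_class.
rewrite muleC /M EFinD !fineK//; apply: le_trans (leeD h1 h2).
rewrite -ge0_muleDr// lee_wpmul2l ?lee_fin ?exprn_ge0 ?(ltW b0)//.
apply: le_trans (measureU2 P0 mA1 mA2).
apply: (@le_measure _ _ _ P0); rewrite ?inE//; first exact: measurableU.
move=> om [_ /= h]; apply: contrapT => /not_orP[/negP + /negP].
by rewrite -leNgt -leqNgt => h1' h2'; apply: h.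
Qed.

End job_law.

(** * Choice of the block lengths *)

(** Equivalent to [expR y^-1 >= 1 + y^-1]. Weights of decay length [y] therefore sum to order [y] in
    each coordinate. *)
Lemma expR_weight_sum_le (R : realType) (y : R) : 0 < y ->
  2 / (1 - expR (- y^-1)) <= 2 * (y + 1).
Proof.
move=> y0; have e1 : 0 < 1 - expR (- y^-1) by rewrite subr_gt0 expR_lt1 oppr_lt0 invr_gt0.
have y1 : 0 < y + 1 by rewrite addr_gt0.
rewrite ler_pM2l// -[y + 1]invrK lef_pV2 ?posrE ?invr_gt0//.
rewrite lerBrDr -lerBrDl expRN.
have -> : 1 - (y + 1)^-1 = (1 + y^-1)^-1 by field; rewrite !gt_eqF// addr_gt0.
by rewrite lef_pV2 ?posrE ?expR_gt0 ?expR_ge1Dx// addr_gt0// invr_gt0.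
Qed.

(** This is [exp(-y) <= y^(-eta)]. With [y = 2 ^+ n / l k], a power separates [n] from [k] and can
    be summed over both. *)
Lemma expRN_le_ln (R : realType) (y eta : R) : 0 < y -> 0 <= eta <= 1 ->
  expR (- y) <= expR (- (eta * ln y)).
Proof.
move=> y0 /andP[e0 e1]; rewrite ler_expR lerN2.
have lny : ln y <= y - 1.
  by have := @le_ln1Dx _ (y - 1); rewrite addrCA subrr addr0; apply; lra.
have [ln0|ln0] := leP 0 (ln y); nra.
Qed.

(* 2 ^ (d + 1) * expR (decay_rate) ^ (2 (d + 1)) = 2 ^ (d + 1 + eps): half of the
   decay of the class probabilities pays for blocks larger than the jobs by a
   factor base_scale * expR (decay_rate) ^ k, the other half makes the number of
   jobs per block decay. *)
Definition decay_rate (R : realType) (d : nat) (eps : R) : R :=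
  eps * ln 2 / (2 * (d%:R + 1)).

(** Chosen so that the full series of [2 ^+ k / class_scale d eps k], which is geometric of ratio
    [expR (- decay_rate d eps)], has sum [1 / (8 d)]. *)
Definition base_scale (R : realType) (d : nat) (eps : R) : R :=
  8 * d%:R / (1 - expR (- decay_rate d eps)).

Definition class_scale (R : realType) (d : nat) (eps : R) (k : nat) : R :=
  base_scale d eps * (2 * expR (decay_rate d eps)) ^+ k.

(** The solution of [eta * (ln 2 + delta) = delta / 2], where [delta] is the decay rate: the power
    [-eta] of [2 ^+ n / class_scale d eps k] then grows in [k] like [expR (k * delta / 2)], half of
    what the decay in [k] can absorb. *)
Definition scale_exponent (R : realType) (d : nat) (eps : R) : R :=
  decay_rate d eps / (2 * (ln 2 + decay_rate d eps)).

Section tail.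
Context {d : nat} {R : realType} {disp : measure_display}.
Context {Omega : measurableType disp} {P : probability Omega R} {lambda : R}.
Context {law : set (R * siteset d) -> \bar R}.
Variable H : poisson_hail P lambda law.
Hypothesis d_gt0 : (0 < d)%N.
Hypothesis lambda_gt0 : 0 < lambda.
Hypothesis law_finite : forall A, measurable A -> law A = (fine (law A))%:E.
Hypothesis law_located : forall k (p : site d * nat) (s : seq (site d)), uniq s ->
  \sum_(w <- s) fine (law (located_class k (p, w))) <= fine (law (size_class k)).
Variables (eps C : R).
Hypothesis eps_gt0 : 0 < eps.
Hypothesis C_gt0 : 0 < C.
Hypothesis law_decay : forall k,
  fine (law (size_class k)) <= C * (2 `^ (d%:R + 1 + eps)) ^- k.

Local Notation delta := (decay_rate d eps).
Local Notation K := (base_scale d eps).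
Local Notation scale := (class_scale d eps).
Local Notation eta := (scale_exponent d eps).

(** The 4 comes from [2 * (y + 1) <= 4 * y] for [y >= 1]. In the last factor, [3 d] per job pays for
    the second term of [critical_length]; of the remaining 2, one unit per job pays for
    [2 ^+ n / scale k] and the other leaves [exp(-m)] for a chain of [m] jobs. *)
Hypothesis lambda_small : lambda * (C * (4 * K) ^+ d.+1 * expR (3 * d%:R + 2)) <= 1.

Let ln2_gt0 : 0 < ln 2 :> R. Proof. by rewrite ln_gt0// ltr1n. Qed.

Let delta_gt0 : 0 < delta.
Proof. by rewrite /decay_rate divr_gt0 ?mulr_gt0// ltr_wpDl. Qed.

Let decay01 : 0 < 1 - expR (- delta) <= 1.
Proof. by rewrite subr_gt0 expR_lt1 oppr_lt0 delta_gt0 gerBl expR_ge0. Qed.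

Let K_ge1 : 1 <= K.
Proof.
have /andP[h0 h1] := decay01; rewrite /base_scale ler_pdivlMr// mul1r.
apply: (le_trans h1); have : 1 <= d%:R :> R by rewrite ler1n.
lra.
Qed.

Let scale_ge k : 2 ^+ k <= scale k.
Proof.
rewrite /class_scale exprMn mulrCA ler_peMr ?exprn_ge0//.
rewrite mulr_ege1// exprn_ege1// -[leLHS]expR0 ler_expR ltW//.
Qed.

Let scale_ge1 k : 1 <= scale k.
Proof. by apply: le_trans (scale_ge k); rewrite exprn_ege1// ler1n. Qed.

Let scale_gt0 k : 0 < scale k.
Proof. exact: lt_le_trans ltr01 (scale_ge1 k). Qed.

Let K_gt0 : 0 < K. Proof. exact: lt_le_trans ltr01 K_ge1. Qed.

Lemma base_scale_gt0 : 0 < K. Proof. exact: K_gt0. Qed.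

Lemma class_scale_gt0 k : 0 < scale k. Proof. exact: scale_gt0. Qed.

Lemma class_scale_sum N : \sum_(k < N) 2 ^+ k / scale k <= (8 * d%:R)^-1.
Proof.
have -> : \sum_(k < N) 2 ^+ k / scale k = K^-1 * \sum_(k < N) expR (- delta) ^+ k.
  rewrite big_distrr/=; apply: eq_bigr => k _.
  rewrite /class_scale exprMn expRN exprVn !invfM mulrCA; congr (_ * _).
  by rewrite mulrA mulfV ?mul1r// expf_neq0.
have /andP[h0 h1] := decay01.
have h : \sum_(k < N) expR (- delta) ^+ k <= (1 - expR (- delta))^-1.
  by apply: sum_geometric_le; rewrite expR_ge0/= -subr_gt0.
apply: (le_trans (ler_wpM2l _ h)); first by rewrite invr_ge0 ltW.
rewrite /base_scale invf_div mulrAC mulfV ?gt_eqF// mul1r.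
exact: lexx.
Qed.

Let q k := fine (law (size_class k)).

Let q_ge0 k : 0 <= q k.
Proof.
have := @law_located k (0, 0%N) [::] isT; rewrite big_nil; exact.
Qed.

Let kappa_le k : lambda * q k * (2 / (1 - expR (- (scale k)^-1))) ^+ d.+1 <=
  expR (- (3 * d%:R + 2)) * expR (- delta) ^+ k.
Proof.
have x01 : expR (- (scale k)^-1) < 1 by rewrite expR_lt1 oppr_lt0 invr_gt0.
have h1 : (2 / (1 - expR (- (scale k)^-1))) ^+ d.+1 <= (4 * scale k) ^+ d.+1.
  rewrite lerXn2r// ?nnegrE.
  - by rewrite divr_ge0// subr_ge0 ltW.
  - by rewrite mulr_ge0// ltW.
  - apply: (le_trans (expR_weight_sum_le (scale_gt0 k))).
    by have := scale_ge1 k; lra.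
apply: (@le_trans _ _ (lambda * (C * (2 `^ (d%:R + 1 + eps)) ^- k) * (4 * scale k) ^+ d.+1)).
  apply: ler_pM => //.
  - by rewrite mulr_ge0// ltW.
  - by rewrite exprn_ge0// divr_ge0// subr_ge0 ltW.
  - by rewrite ler_pM2l// law_decay.
have twoE : 2 = expR (ln 2) :> R by rewrite lnK// posrE.
(* By the choice of [delta], [eps * ln 2 = 2 * (d + 1) * delta]; the growth of the block volume uses
   up half of it. *)
have powE : (2 * expR delta) ^+ d.+1 / 2 `^ (d%:R + 1 + eps) =
    expR (- delta) ^+ d.+1.
  rewrite {1}twoE -expRD -expRM_natl /powR pnatr_eq0/= -expRN -expRD -expRM_natl.
  congr expR; rewrite /decay_rate -natr1; field.
  by rewrite gt_eqF// ltr_wpDl.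
have -> : lambda * (C * (2 `^ (d%:R + 1 + eps)) ^- k) * (4 * scale k) ^+ d.+1 =
    lambda * (C * (4 * K) ^+ d.+1) * (expR (- delta) ^+ d.+1) ^+ k.
  have -> : (4 * scale k) ^+ d.+1 = (4 * K) ^+ d.+1 * ((2 * expR delta) ^+ d.+1) ^+ k.
    by rewrite /class_scale mulrA [LHS]exprMn -!exprM [(k * _)%N]mulnC.
  by rewrite -powE expr_div_n; ring.
apply: ler_pM.
- by rewrite mulr_ge0 ?(ltW lambda_gt0)// mulr_ge0 ?(ltW C_gt0)// exprn_ge0// mulr_ge0// ltW.
- by rewrite !exprn_ge0// expR_ge0.
- rewrite expRN -[leRHS]mul1r ler_pdivlMr ?expR_gt0//.
  by move: lambda_small; rewrite !mulrA.
rewrite -exprM ler_wiXn2l// ?expR_ge0//; last by rewrite leq_pmull.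
by rewrite -expR0 ler_expR oppr_le0 ltW.
Qed.

Lemma prob_bad_event (x : site d) (i0 n k : nat) :
  (P (bad_event H scale x i0 n k) <=
    (expR (eta * ln K) * expR (- (eta * ln 2)) ^+ n * expR (- (delta / 2)) ^+ k)%:E)%E.
Proof.
set xk := expR (- (scale k)^-1).
have xk01 : 0 < xk < 1 by rewrite expR_gt0/= expR_lt1 oppr_lt0 invr_gt0.
set m := critical_size scale n k.
have mgt : 2 ^+ n / scale k <= m%:R by exact/ltW/truncnS_gt.
have m1 : 1 <= m%:R :> R by rewrite ler1n.
apply: (le_trans (@prob_chains _ _ _ _ _ _ _ H (located_class k)
  (fun l => fine (law (located_class k l))) _ _ lambda_gt0 (q k) xk xk01 _ (x, i0) m _)).
- by move=> l; exact: measurable_located_class.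
- by move=> l; apply: law_finite; exact: measurable_located_class.
- by move=> p s us; exact: law_located.
rewrite lee_fin.
apply: (@le_trans _ _ (expR (2 ^+ n / scale k + 3 * d%:R * m%:R) *
   (expR (- (3 * d%:R + 2)) * expR (- delta) ^+ k) ^+ m)).
  apply: ler_pM.
  - by rewrite invr_ge0 exprn_ge0// ltW; case/andP: xk01.
  - rewrite exprn_ge0// mulr_ge0 ?mulr_ge0 ?(ltW lambda_gt0)// exprn_ge0// divr_ge0//.
    by rewrite subr_ge0 ltW; case/andP: xk01.
  - rewrite /xk -exprVn -expRN opprK -expRM_natl ler_expR /critical_length -/m.
    have -> : (2 ^ n + m * (3 * (d * 2 ^ k)))%:R =
        2 ^+ n + 3 * d%:R * m%:R * 2 ^+ k :> R.
      by rewrite natrD natrX (natrM _ m) (natrM _ 3%N) (natrM _ d) natrX; ring.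
    by rewrite mulrDl lerD// ler_pdivrMr// ler_wpM2l.
  - rewrite lerXn2r// ?nnegrE ?kappa_le//.
      rewrite !mulr_ge0 ?(ltW lambda_gt0)// exprn_ge0// divr_ge0//.
      by rewrite subr_ge0 ltW; case/andP: xk01.
rewrite exprMn -exprM -!expRM_natl -!expRD ler_expR.
have y0 : 0 < 2 ^+ n / scale k by rewrite divr_gt0 ?exprn_gt0.
have eta01 : 0 <= eta <= 1.
  have den : 0 < 2 * (ln 2 + delta) by rewrite mulr_gt0// addr_gt0.
  apply/andP; split; first exact: divr_ge0 (ltW delta_gt0) (ltW den).
  by rewrite /scale_exponent ler_pdivrMr// mul1r; have := ln2_gt0; have := delta_gt0; lra.
(* With [y = 2 ^+ n / scale k <= m] and [1 <= m], the exponent obtained so far,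
   [y - 2 m - delta k m], is at most [- y - delta k]. It remains to replace [exp(-y)] by a power of
   [y]. *)
have := expRN_le_ln y0 eta01; rewrite ler_expR.
have -> : ln (2 ^+ n / scale k) = n%:R * ln 2 - ln K - k%:R * (ln 2 + delta).
  have e_gt0 : 0 < 2 * expR delta by rewrite mulr_gt0// expR_gt0.
  rewrite ln_div ?posrE ?exprn_gt0// lnXn// /class_scale (lnM K_gt0 (exprn_gt0 k e_gt0)).
  rewrite (lnXn k e_gt0) lnM ?posrE ?expR_gt0// expRK.
  by rewrite -[_ *+ n]mulr_natl -[_ *+ k]mulr_natl; ring.
have etaE : eta * (ln 2 + delta) = delta / 2.
  by rewrite /scale_exponent; field; rewrite gt_eqF// addr_gt0.
have dk : delta * k%:R <= delta * k%:R * m%:R.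
  by rewrite ler_peMr// mulr_ge0// ltW.
rewrite natrM.
have -> : - (eta * (n%:R * ln 2 - ln K - k%:R * (ln 2 + delta))) =
  - (eta * ln 2 * n%:R) + eta * ln K + k%:R * (eta * (ln 2 + delta)) by ring.
rewrite etaE; move: mgt dk; set y := _ / _; set A := eta * ln K.
set B := eta * ln 2 * n%:R; move=> mgt dk hy.
have : k%:R * m%:R * - delta = - (delta * k%:R * m%:R) by ring.
have : m%:R * - (3 * d%:R + 2) = - (3 * d%:R * m%:R) - 2 * m%:R :> R by ring.
have : n%:R * - (eta * ln 2) = - B by rewrite /B; ring.
have : k%:R * - (delta / 2) = - (delta * k%:R / 2) by ring.
have : k%:R * (delta / 2) = delta * k%:R / 2 by ring.
move: hy; lra.
Qed.

Lemma prob_bad_tail (x : site d) (i0 n0 : nat) :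
  (P (\bigcup_(nk in [set nk : nat * nat | (n0 <= nk.1)%N])
       bad_event H scale x i0 nk.1 nk.2) <=
    (expR (eta * ln K) * expR (- (eta * ln 2)) ^+ n0 /
      ((1 - expR (- (eta * ln 2))) * (1 - expR (- (delta / 2)))))%:E)%E.
Proof.
set r1 := expR (- (eta * ln 2)); set r2 := expR (- (delta / 2)).
have eta0 : 0 < eta by rewrite /scale_exponent divr_gt0 ?mulr_gt0 ?addr_gt0.
have r1_1 : r1 < 1 by rewrite expR_lt1 oppr_lt0 mulr_gt0.
have r2_1 : r2 < 1 by rewrite expR_lt1 oppr_lt0 divr_gt0.
have r1_0 : 0 <= r1 by exact: expR_ge0.
have r2_0 : 0 <= r2 by exact: expR_ge0.
apply: measure_bigcup_le => [[n k]|s us sD].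
  apply: countable_bigcup_measurable => ls _.
  by apply: measurable_chain_event => l; exact: measurable_located_class.
set c := expR (eta * ln K).
have c0 : 0 <= c by exact: expR_ge0.
apply: (@le_trans _ _ (\sum_(nk <- s) (c * r1 ^+ nk.1 * r2 ^+ nk.2)%:E)%E).
  by apply: lee_sum => -[n k] _; exact: prob_bad_event.
rewrite sumEFin lee_fin.
have [N sN] : exists N, forall nk, nk \in s -> (nk.1 < N)%N /\ (nk.2 < N)%N.
  exists (\max_(nk <- s) maxn nk.1 nk.2).+1 => nk nks; apply/andP.
  by rewrite -gtn_max ltnS (big_rem _ nks)/= leq_maxl.
apply: (@le_trans _ _ (\sum_(nk <- [seq (n, k) | n <- iota n0 N, k <- iota 0 N])
    c * r1 ^+ nk.1 * r2 ^+ nk.2)).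
  apply: ler_sum_subseq => // [nk nks|nk]; last by rewrite !mulr_ge0 ?exprn_ge0.
  have [h1 h2] := sN _ nks; have /= h3 := sD _ nks.
  apply/allpairsP; exists nk; rewrite !mem_iota h3 /= ltn_addl// add0n h2.
  by split=> //; case: (nk).
rewrite big_allpairs_dep/=.
under eq_bigr do rewrite -big_distrr/=.
rewrite -big_distrl/= -big_distrr/= invfM mulrA.
have E1 : \sum_(i <- iota n0 N) r1 ^+ i <= r1 ^+ n0 * (1 - r1)^-1.
  rewrite -[n0]addn0 iotaDl big_map; under eq_bigr do rewrite exprD.
  rewrite addn0 -big_distrr/= ler_wpM2l ?exprn_ge0//.
  have := sum_geometric_le N (_ : 0 <= r1 < 1); rewrite -(big_mkord xpredT (fun i => r1 ^+ i)).
  by rewrite /index_iota subn0; apply; rewrite r1_0.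
have E2 : \sum_(i <- iota 0 N) r2 ^+ i <= (1 - r2)^-1.
  have := sum_geometric_le N (_ : 0 <= r2 < 1); rewrite -(big_mkord xpredT (fun i => r2 ^+ i)).
  by rewrite /index_iota subn0; apply; rewrite r2_0.
apply: ler_pM => //.
- by rewrite mulr_ge0// sumr_ge0// => i _; rewrite exprn_ge0.
- by rewrite sumr_ge0// => i _; rewrite exprn_ge0.
- by rewrite -mulrA ler_wpM2l.
Qed.

(** [n0] is chosen before [x] and [i0]. Uniformity in the slot [i0] containing the observation time
    is what yields tightness over all times. *)
Lemma bad_tail_cvg (e : R) : 0 < e -> exists n0, forall x i0,
  (P (\bigcup_(nk in [set nk : nat * nat | (n0 <= nk.1)%N])
       bad_event H scale x i0 nk.1 nk.2) <= e%:E)%E.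
Proof.
move=> e0; set r1 := expR (- (eta * ln 2)); set r2 := expR (- (delta / 2)).
have eta0 : 0 < eta by rewrite /scale_exponent divr_gt0 ?mulr_gt0 ?addr_gt0.
have r1_1 : r1 < 1 by rewrite expR_lt1 oppr_lt0 mulr_gt0.
have r2_1 : r2 < 1 by rewrite expR_lt1 oppr_lt0 divr_gt0.
pose c := expR (eta * ln K) / ((1 - r1) * (1 - r2)).
have c0 : 0 < c by rewrite divr_gt0 ?expR_gt0// mulr_gt0// subr_gt0.
have /cvgrPdist_le /(_ (e / c) (divr_gt0 e0 c0)) [n0 _ /(_ n0 (leqnn _))] :
    (r1 ^+ n) @[n --> \oo] --> (0 : R).
  by apply: cvg_expr; rewrite ger0_norm ?expR_ge0.
rewrite /= sub0r normrN ger0_norm ?exprn_ge0 ?expR_ge0// ler_pdivlMr// => h.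
exists n0 => x i0; apply: (le_trans (prob_bad_tail x i0 n0)).
by rewrite lee_fin; apply: le_trans h; rewrite /c [leRHS]mulrCA [leRHS]mulrA.
Qed.

End tail.

Theorem theorem1 (R : realType) (d : nat) (d_ge1 : (1 <= d)%N)
    (disp0 : measure_display) (Omega0 : measurableType disp0)
    (P0 : probability Omega0 R)
    (tau : {RV P0 >-> R}) (B : {RV P0 >-> siteset d})
    (tau_ge0 : {ae P0, forall om, 0 <= tau om})
    (B_neq0 : {ae P0, forall om, B om <> fset0})
    (eps : R) (eps_gt0 : 0 < eps)
    (moments : ('E_P0[fun om => (tau om `^ (d%:R + 1 + eps))%R] +
      'E_P0[fun om => ((diam (B om))%:R `^ (d%:R + 1 + eps))%R] < +oo)%E) :
  exists2 lambda0 : R, 0 < lambda0 &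
    forall lambda : R, 0 < lambda -> lambda < lambda0 ->
    forall (disp : measure_display) (Omega : measurableType disp)
      (P : probability Omega R)
      (H : poisson_hail P lambda (pushforward P0 (fun om => (tau om, B om)))),
      stable H.
Proof.
have alpha_ge0 : 0 <= d%:R + 1 + eps by rewrite addr_ge0 ?ltW// addr_ge0.
have [C C_gt0 decay] := size_class_decay alpha_ge0 moments.
set M := C * (4 * base_scale d eps) ^+ d.+1 * expR (3 * d%:R + 2).
have M_gt0 : 0 < M.
  rewrite mulr_gt0 ?expR_gt0// mulr_gt0// exprn_gt0// mulr_gt0//.
  exact: (base_scale_gt0 d_ge1 eps_gt0).
exists M^-1; first by rewrite invr_gt0.
move=> lambda lambda_gt0 lambda_lt disp Omega P H x.
have lambda_small : lambda * M <= 1 by rewrite -ler_pdivlMr// mul1r ltW.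
split=> [t|e e_gt0]; first exact: measurable_workload.
have [n0 tail] := bad_tail_cvg H d_ge1 lambda_gt0 (@law_fin _ _ _ _ _ tau B)
  (@sum_located_class _ _ _ _ _ tau B) eps_gt0 C_gt0 decay lambda_small e_gt0.
(* The workload is nonnegative and, off the bad events, at most [2 ^+ n0], hence also finite
   there. *)
exists `[0, 2 ^+ n0]%classic; first exact: segment_compact.
move=> t t_ge0; set i0 := Num.truncn t.
have ti0 : i0%:R <= t <= i0.+1%:R.
  by apply/andP; split; [rewrite truncn_le|exact/ltW/truncnS_gt].
apply: le_trans (tail x i0).
have mW : measurable_fun setT (workload H t x) by exact: measurable_workload.
apply: (@le_measure _ _ _ P); rewrite ?inE.
- rewrite -[X in measurable X]setTI; apply: mW => //; apply: measurableC.
  by apply: measurable_image_EFin; exact: measurable_itv.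
- apply: countable_bigcup_measurable => nk _; apply: countable_bigcup_measurable => ls _.
  by apply: measurable_chain_event => l; exact: measurable_located_class.
move=> om /= notK; apply: contrapT => good; apply: notK.
have W_le : (workload H t x om <= (2 ^+ n0)%:E)%E.
  apply: (workload_off_bad (l := class_scale d eps) d_ge1 _ _ ti0).
  - exact: (class_scale_gt0 d_ge1 eps_gt0).
  - exact: (class_scale_sum d_ge1 eps_gt0).
  - by move=> n k n0n bad; apply: good; exists (n, k).
have W_ge : (0 <= workload H t x om)%E by exact: workload_ge0.
have W_fin : workload H t x om \is a fin_num.
  by rewrite ge0_fin_numE// (le_lt_trans W_le)// ltry.
exists (fine (workload H t x om)); last by rewrite fineK.
by rewrite /= in_itv/= fine_ge0//= -lee_fin fineK.
Qed.
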